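(* Let $F$ be a finitely generated free profinite group, and let $H$ be a closed subgroup of infinite index in $F$. Suppose that there is a closed normal subgroup $N$ of $F$ with $N\le H$, such that for some profinite basis $X$ of $F$, $N$ contains a nontrivial element of the abstract subgroup of $F$ generated by $X$ (that is, $N$ contains a nontrivial finite word in the elements of $X$ and their inverses). Then $H$ is a free profinite group of rank $\aleph_0$.
   Context: A subset $X$ of a profinite group $G$ generates $G$ if the abstract subgroup generated by $X$ is dense in $G$; $X$ converges to $1$ if every open subgroup of $G$ contains all but finitely many elements of $X$. A profinite group $F$ is a free profinite group if it is generated by a subset $X$ converging to $1$ (called a profinite basis, or basis) such that every function $\alpha\colon X\to L$ to a finite group $L$ with $\alpha(x)\neq 1$ for only finitely many $x\in X$ extends to a continuous homomorphism $F\to L$. The rank of $F$ is $|X|$ (independent of the choice of the basis). A profinite group is finitely generated if it has a finite subset such that the abstract subgroup generated by this subset is dense in the group. *)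

(* Defs.v *)
From HB Require Import structures.
From mathcomp Require Import all_boot all_order fingroup.
From mathcomp Require Import all_classical topology.

Set Implicit Arguments.
Unset Strict Implicit.
Unset Printing Implicit Defensive.

Local Open Scope classical_set_scope.
Local Open Scope card_scope.
Local Open Scope group_scope.

HB.mixin Record isTopologicalGroup G & Topological G & monoid.Group G := {
  mulg_continuous : continuous (fun x : G * G => x.1 * x.2);
  invg_continuous : continuous (fun x : G => x^-1)
}.

#[short(type="topologicalGroupType")]
HB.structure Definition TopologicalGroup :=
  {G of Topological G & monoid.Group G & isTopologicalGroup G}.

Definition is_subgroup (G : groupType) (H : set G) : Prop := group_closed (mem H).

Record subgroup (G : groupType) := Subgroup {
  subgroup_set :> set G;
  subgroup_setP : is_subgroup subgroup_set
}.

(* The group H as a type of its own, with the operations and the subspace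
   topology inherited from G. *)
Definition subgroup_type (G : topologicalGroupType) (H : subgroup G) : Type :=
  set_type H.

Section SubgroupType.
Context (G : topologicalGroupType) (H : subgroup G).

HB.instance Definition _ := SubChoice.on (subgroup_type H).
HB.instance Definition _ := Topological.copy (subgroup_type H) (set_type H).
HB.instance Definition _ :=
  SubChoice_isSubGroup.Build G _ (subgroup_type H) (subgroup_setP H).

Lemma subgroup_val_continuous : continuous (val : subgroup_type H -> G).
Proof. exact: (@initial_continuous (set_type H) G set_val). Qed.

Let continuous_valP (T : topologicalType) (f : T -> subgroup_type H) :
  continuous (val \o f) -> continuous f.
Proof. exact: (@continuous_comp_initial (set_type H) T G set_val f). Qed.

Let subgroup_mulg_continuous :
  continuous (fun x : subgroup_type H * subgroup_type H => x.1 * x.2).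
Proof.
apply: continuous_valP => x.
rewrite (_ : _ \o _ = (fun y : G * G => y.1 * y.2) \o
    (fun z : subgroup_type H * subgroup_type H => (val z.1, val z.2))); last first.
  by apply/funext => z; exact: valM.
apply: continuous_comp; last exact: mulg_continuous.
by apply: cvg_pair; apply: continuous_comp;
  [exact: cvg_fst|exact: subgroup_val_continuous
  |exact: cvg_snd|exact: subgroup_val_continuous].
Qed.

Let subgroup_invg_continuous :
  continuous (fun x : subgroup_type H => x^-1).
Proof.
apply: continuous_valP => x.
rewrite (_ : _ \o _ = (fun y : G => y^-1) \o (val : subgroup_type H -> G)).
  by apply: continuous_comp;
    [exact: subgroup_val_continuous|exact: invg_continuous].
by apply/funext => z; exact: (gmulfV (val : {multiplicative _ -> _})).
Qed.

HB.instance Definition _ := isTopologicalGroup.Build (subgroup_type H)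
  subgroup_mulg_continuous subgroup_invg_continuous.

End SubgroupType.

Definition normal_subgroup (G : groupType) (N : set G) : Prop :=
  forall x y : G, N x -> N (x ^ y).

Definition left_cosets (G : groupType) (H : set G) : set (set G) :=
  range (fun x : G => [set x * h | h in H]).

Definition infinite_index (G : groupType) (H : set G) : Prop :=
  infinite_set (left_cosets H).

Definition generated_subgroup (G : groupType) (X : set G) : set G :=
  smallest (@is_subgroup G) X.

Section Profinite.
Context (G : topologicalGroupType).
Implicit Types X : set G.

Definition profinite_group : Prop :=
  [/\ compact [set: G], hausdorff_space G & totally_disconnected [set: G]].

Definition generates X : Prop := dense (generated_subgroup X).

Definition converges_to_1 X : Prop :=
  forall U : set G, is_subgroup U -> open U -> finite_set (X `\` U).

(* A function X -> L is represented by a total function alpha : G -> L, of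
   which only the values on X are used. *)
Definition profinite_basis X : Prop :=
  [/\ generates X, converges_to_1 X &
      forall (L : finGroupType) (alpha : G -> L),
        finite_set [set x | X x /\ alpha x <> 1] ->
        exists f : {multiplicative G -> L},
          continuous (f : G -> discrete_topology L) /\
          {in X, f =1 alpha}].

Definition free_profinite_group : Prop :=
  profinite_group /\ exists X, profinite_basis X.

Definition free_profinite_group_of_rank_aleph0 : Prop :=
  profinite_group /\ exists2 X, profinite_basis X & X #= [set: nat].

Definition topologically_finitely_generated : Prop :=
  exists2 X, finite_set X & generates X.

End Profinite.

(* Main.v *)
From HB Require Import structures.
Require Import Defs.
From mathcomp Require Import finmap.
From mathcomp Require Import all_boot all_order fingroup perm gproduct.
From mathcomp Require Import all_classical topology.

Set Implicit Arguments.
Unset Strict Implicit.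
Unset Printing Implicit Defensive.

Local Open Scope classical_set_scope.
Local Open Scope group_scope.

(** Write F for the free group, X for a finite basis, w for a word in X whose
    conjugates lie in H.

    The proof goes through Iwasawa's criterion: a profinite group with
    countably many open subgroups in which every finite embedding problem has a
    surjective solution is free on a sequence converging to 1
    (embedding_solvable_basis). The basis is built stage by stage. A stage is a
    finite quotient of the group together with a finite list of generators;
    solving an embedding problem refines it so that the generators can be sent
    to values given in advance, and the refined generators converge.

    So let q : H -> A be continuous and h : B -> A a homomorphism with image
    q(H). Choose a finite quotient rho : F -> R that is fine enough for q to
    factor through J = rho(H), and consider the Schreier graph of the right
    cosets of J, with one edge for each coset and each x in X. Since F is free,
    it acts on R x B by letting x multiply the first coordinate by rho(x) and
    the second one by a label of the edge that is crossed, and the labels can be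
    chosen freely (label_cocycle). Reading off the second coordinate of the
    orbit of (1, 1) gives a homomorphism on H, and it lifts q as soon as each
    label lifts a prescribed element of A. No basis of an open subgroup of F is
    ever needed.

    It remains to choose the labels so that the image of H is everything. Here
    w comes in: it labels closed paths of the Schreier graph. Among all
    nontrivial words w for which g w g^-1 is in H for all g in some nonempty open
    set, take a shortest one. A proper subword fixes no open set of cosets, so
    at generic points w runs through a simple closed path; and since H, being of
    infinite index, has empty interior, there are as many such points with
    pairwise disjoint paths as one likes (separated_loops). Removing one edge
    from each of these disjoint cycles leaves the graph connected, as one can
    walk around the rest of the cycle (avoiding_word). Hence each cycle is
    reached along edges that are kept, and the label of the removed edge
    controls the value of the lift at a conjugate of w in H: these values can be
    any lifts of the values of q (prescribed_lift). With more than |A| cycles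
    for each k in the kernel of h, two of them have the same value under q; give
    the two lifts quotient k. The image of H then contains the kernel, hence is
    everything (subgroup_embedding_solvable). *)

(** * Topological groups and their homomorphisms to finite groups *)

Section TopGroup.
Context (G : topologicalGroupType).

Lemma subgroup1 (S : set G) : is_subgroup S -> S 1.
Proof. by case=> /set_mem. Qed.

Lemma subgroupM (S : set G) x y : is_subgroup S -> S x -> S y -> S (x * y).
Proof.
by move=> /group_closedM SM /mem_set Sx /mem_set Sy; apply: set_mem; exact: SM.
Qed.

Lemma subgroupV (S : set G) x : is_subgroup S -> S x -> S x^-1.
Proof. by move=> /group_closedV SV /mem_set Sx; apply: set_mem; exact: SV. Qed.

Lemma is_subgroupP (S : set G) :
  S 1 -> (forall x y, S x -> S y -> S (x * y^-1)) -> is_subgroup S.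
Proof.
move=> S1 SF; split; first exact: mem_set.
by move=> x y /set_mem Sx /set_mem Sy; apply: mem_set; exact: SF.
Qed.

Lemma mull_continuous (a : G) : continuous (fun x : G => a * x).
Proof.
move=> x; rewrite (_ : (fun _ => _) = (fun z : G * G => z.1 * z.2) \o pair a) //.
apply: continuous_comp; last exact: mulg_continuous.
by apply: cvg_pair; [exact: cvg_cst|exact: cvg_id].
Qed.

Lemma mulr_continuous (a : G) : continuous (fun x : G => x * a).
Proof.
move=> x; rewrite (_ : (fun _ => _) = (fun z : G * G => z.1 * z.2) \o pair^~ a) //.
apply: continuous_comp; last exact: mulg_continuous.
by apply: cvg_pair; [exact: cvg_id|exact: cvg_cst].
Qed.

Lemma nbhs_mull (a x : G) (A : set G) :
  nbhs (a * x) A -> nbhs x [set y | A (a * y)].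
Proof. exact: mull_continuous. Qed.

Lemma nbhs_mulr (a x : G) (A : set G) :
  nbhs (x * a) A -> nbhs x [set y | A (y * a)].
Proof. exact: mulr_continuous. Qed.

Lemma nbhs_mul (x y : G) (A : set G) :
  nbhs (x * y) A -> \forall u \near x & v \near y, A (u * v).
Proof. exact: (@mulg_continuous G (x, y)). Qed.

Lemma compact_cover_compact :
  compact [set: G] -> cover_compact [set: G].
Proof.
pose T : ptopologicalType := HB.pack (TopologicalGroup.sort G) (isPointed.Build G 1).
by rewrite -[compact _]/(@compact T _) compact_cover.
Qed.

(** For a homomorphism, being trivial near 1 amounts to continuity into the
    discrete topology. *)
Definition finite_hom (R : finGroupType) (f : G -> R) : Prop :=
  {morph f : x y / x * y} /\ \forall x \near (1 : G), f x = 1.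

Section FiniteHom.
Context (R : finGroupType) (f : G -> R) (f_hom : finite_hom f).

Lemma finite_homM x y : f (x * y) = f x * f y.
Proof. exact: f_hom.1. Qed.

Lemma finite_hom1 : f 1 = 1.
Proof. by apply: (mulgI (f 1)); rewrite -finite_homM !mulg1. Qed.

Lemma finite_homV x : f x^-1 = (f x)^-1.
Proof. by apply: (mulgI (f x)); rewrite -finite_homM !mulgV finite_hom1. Qed.

Lemma finite_hom_near x : \forall y \near x, f y = f x.
Proof.
have /nbhs_mull : nbhs (x^-1 * x) [set y | f y = 1] by rewrite mulVg; exact: f_hom.2.
apply: filterS => y /=; rewrite finite_homM finite_homV => /eqP.
by rewrite mulg_eq1 eqg_inv eq_sym => /eqP.
Qed.

Lemma finite_hom_open (A : set R) : open (f @^-1` A).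
Proof.
rewrite openE => x /= Ax; have := finite_hom_near x.
by apply: filterS => y /= ->.
Qed.

Lemma finite_hom_continuous : continuous (f : G -> discrete_topology R).
Proof.
by apply/continuousP => A _; exact: finite_hom_open.
Qed.

End FiniteHom.

Lemma continuous_finite_hom (R : finGroupType) (f : {multiplicative G -> R}) :
  continuous (f : G -> discrete_topology R) -> finite_hom f.
Proof.
move=> fc; split; first exact: gmulfM.
have f1 : f 1 = 1 by apply: (mulgI (f 1)); rewrite -gmulfM !mulg1.
have := fc 1 [set 1].
by rewrite /= f1; apply; exact: discrete_set1.
Qed.

End TopGroup.

(** * Small open subgroups of profinite groups *)

Lemma compact_filtered_subset (T : topologicalType) (I : Type) (D : set I)
    (C : I -> set T) (O : set T) :
  compact [set: T] -> D !=set0 -> (forall i, D i -> closed (C i)) ->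
  (forall i j, D i -> D j -> exists2 k, D k & C k `<=` C i `&` C j) ->
  open O -> \bigcap_(i in D) C i `<=` O -> exists2 i, D i & C i `<=` O.
Proof.
move=> cT [i0 Di0] clC dirC oO sub; apply: contrapT => nsub.
pose B := filter_from D (fun i => C i `\` O).
have FB : Filter B.
  apply: filter_from_filter; first by exists i0.
  move=> i j Di Dj; have [k Dk Ck] := dirC i j Di Dj; exists k => //.
  by move=> x [/Ck[]].
have PB : ProperFilter B.
  apply: filter_from_proper => i Di; apply: contrapT => CO0; apply: nsub.
  exists i => // x Cx; apply: contrapT => nOx; apply: CO0.
  by exists x.
have [p [_ clp]] := cT B PB filterT.
have CBp i : D i -> (C i `\` O) p.
  move=> Di; have cl : closed (C i `\` O).
    by apply: closedI; [exact: clC|exact: open_closedC].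
  apply: cl => A /(clp (C i `\` O)); apply.
  by exists i.
by have [_ []] := CBp _ Di0; apply: sub => i /CBp[].
Qed.

(** The intersection Q of the clopen neighbourhoods of x is connected: if Q
    splits into two closed pieces, normality separates them by an open set V,
    and by compactness some clopen C around Q avoids the boundary of V, so that
    C `&` V is clopen and contains only one of the pieces. *)
Lemma totally_disconnected_zero_dimensional (T : topologicalType) :
  compact [set: T] -> hausdorff_space T -> totally_disconnected [set: T] ->
  zero_dimensional T.
Proof.
move=> cT hT tdT x y xy; apply: contrapT => nsep.
pose D : set (set T) := [set C | clopen C /\ C x].
pose Q := \bigcap_(C in D) C.
have Qx : Q x by move=> C [].
have Qy : Q y.
  by move=> C [cC Cx]; apply: contrapT => nCy; apply: nsep; exists C.
have DT : D setT by split=> //; exact: clopenT.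
have Dcl C : D C -> closed C by case=> -[].
have DI C C' : D C -> D C' -> exists2 E, D E & E `<=` C `&` C'.
  move=> [cC Cx] [cC' C'x]; exists (C `&` C') => //; split=> //.
  exact: clopenI.
have clQ : closed Q by apply: closed_bigI => C /Dcl.
have smallD O : open O -> Q `<=` O -> exists2 C, D C & C `<=` O.
  by move=> oO; apply: (@compact_filtered_subset T _ D id) => //; exists setT.
suff : connected Q.
  move=> cQ; have := tdT x I; move/seteqP => [/(_ y) + _] => /(_ _)/=.
  move=> yx; move: xy; rewrite yx ?eqxx //.
  by exists Q.
apply/connectedP => E [E0 QE [sep1 sep2]].
wlog Ex : E E0 QE sep1 sep2 / E false x.
  move=> wl; have := Qx; rewrite QE => -[Ex|Ex]; first exact: (wl E).
  by apply: (wl (E \o negb)) => //=; [rewrite QE setUC|rewrite setIC|rewrite setIC].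
have clE b : closed (E b).
  move=> z clz; have Qz : Q z.
    apply: clQ; apply: closure_subset clz => u Eu; rewrite QE.
    by case: b Eu; [right|left].
  move: Qz; rewrite QE => -[]; case: b clz => // clz Ez.
  - by have : set0 z by rewrite -sep2.
  - by have : set0 z by rewrite -sep1.
have [|U nU clU] := @compact_normal _ hT cT (E false) (clE false) (~` E true).
  apply/set_nbhsP; exists (~` E true); split=> //.
    exact: closed_openC.
  by move=> z E0z E1z; have : set0 z by rewrite -sep2; split=> //; exact: subset_closure.
have /set_nbhsP[V [oV EV VU]] := nU.
have [z Ez] := E0 true.
have [C DC CO] : exists2 C, D C & C `<=` V `|` ~` closure V.
  apply: smallD; first by apply: openU => //; apply: closed_openC; exact: closed_closure.
  move=> u; rewrite QE => -[/EV|Eu]; first by left.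
  by right => /(closureS VU) /clU.
have CVE : C `&` V = C `&` closure V.
  apply/seteqP; split=> u [Cu Vu]; split=> //; first exact: subset_closure.
  by case: (CO _ Cu).
have [[oC clC] Cx] := DC.
have DCV : D (C `&` V).
  split; last by split=> //; exact: EV.
  by split; [exact: openI|rewrite CVE; apply: closedI => //; exact: closed_closure].
have Qz : Q z by rewrite QE; right.
by have [_ /VU/subset_closure/clU] := Qz _ DCV.
Qed.

Section SmallHoms.
Context (G : topologicalGroupType).

Lemma open_subgroup (S : set G) : is_subgroup S -> nbhs 1 S -> open S.
Proof.
move=> Sg S1; rewrite openE => x Sx.
have /nbhs_mull : nbhs (x^-1 * x) S by rewrite mulVg.
apply: filterS => y /= Sy; rewrite -(mulVKg x y).
exact: subgroupM.
Qed.

(** The stabiliser of C under right translation is a subgroup contained in C,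
    because 1 is in C; it is open by compactness. *)
Lemma clopen_open_subgroup (C : set G) :
  compact [set: G] -> clopen C -> C 1 ->
  exists S, [/\ is_subgroup S, open S & S `<=` C].
Proof.
move=> cG [oC clC] C1.
pose S := [set v | forall c, C c <-> C (c * v)].
have Sg : is_subgroup S.
  apply: is_subgroupP; first by move=> c; rewrite mulg1.
  move=> x y Sx Sy c; rewrite mulgA; split.
    by move=> /Sx Cx; apply/Sy; rewrite mulgVK.
  by move=> /Sy; rewrite mulgVK => Cx; apply/Sx.
exists S; split=> //; last by move=> v /(_ 1); rewrite mul1g => -[+ _]; apply.
suff stab (c : G) : [set: G] c -> \forall c' \near c & v \near (1 : G), C c' <-> C (c' * v).
  apply: open_subgroup => //.
  have /compact_near_coveringP cov := cG.
  have : \forall v \near (1 : G), [set: G] `<=` [set c | C c <-> C (c * v)].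
    apply: (cov _ _ (fun v c => C c <-> C (c * v))); exact: stab.
  by apply: filterS => v Sv c; exact: Sv.
have stab (D : set G) : open D -> D c ->
    \forall c' \near c & v \near (1 : G), D c' /\ D (c' * v).
  move=> oD Dc; apply: filterI.
    by exists (D, setT) => /=; [split; [exact: open_nbhs_nbhs|exact: filterT]|case=> u v []].
  by apply: nbhs_mul; rewrite mulg1; exact: open_nbhs_nbhs.
move=> _; have [Cc|nCc] := pselect (C c).
  by apply: filterS (stab C oC Cc) => -[u v] /= [].
by apply: filterS (stab (~` C) (closed_openC clC) nCc) => -[u v] /= [].
Qed.

Lemma finite_cosets (S : set G) : compact [set: G] -> is_subgroup S -> open S ->
  exists (T : finType) (c : G -> T),
    (forall t, exists x, c x = t) /\ forall x y, c x = c y <-> S (x * y^-1).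
Proof.
move=> /compact_cover_compact cG Sg oS.
pose coset (y : G) := [set z | S (z * y^-1)].
have cosetP x y : coset x = coset y <-> S (x * y^-1).
  split=> [E|Sxy].
    have : coset x x by rewrite /coset /= mulgV; exact: subgroup1.
    by rewrite E.
  apply/seteqP; split=> z; rewrite /coset /= => Sz.
    by rewrite -(divgKA x); exact: subgroupM.
  by rewrite -(divgKA y) -(invgF x); apply: subgroupM => //; exact: subgroupV.
have [D _ cov] : finite_subset_cover [set: G] coset [set: G].
  apply: cG => [y _|y _]; last by exists y => //; rewrite /coset /= mulgV; exact: subgroup1.
  by have /continuousP := @mulr_continuous G y^-1; apply.
have sub : range coset `<=` [set coset x | x in [set` D]].
  move=> _ [y _ <-]; have [i Di yi] := cov y I.
  by exists i => //; apply/esym/cosetP.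
have Fin : finite_set (range coset).
  by apply: sub_finite_set sub _; apply: finite_image; exact: finite_fset.
pose T := fset_set (range coset).
have cT y : coset y \in T by rewrite in_fset_set // mem_set //; exists y.
exists T, (fun y => FSetSub (cT y)); split=> [[t tT]|x y].
  have := tT; rewrite in_fset_set // => /set_mem[y _ yt].
  by exists y; exact: val_inj.
by rewrite -cosetP; split=> [[]|E] //; apply: val_inj.
Qed.

(** The permutation action on the finitely many right cosets of S; its kernel,
    the normal core of S, is open by compactness. *)
Lemma open_subgroup_finite_hom (S : set G) :
  compact [set: G] -> is_subgroup S -> open S ->
  exists (R : finGroupType) (f : G -> R),
    finite_hom f /\ forall x, f x = 1 -> S x.
Proof.
move=> cG Sg oS; have [T [c [c_surj cP]]] := finite_cosets cG Sg oS.
pose rep t := sval (cid (c_surj t)).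
have repK t : c (rep t) = t by rewrite /rep; case: cid.
pose act v t := c (rep t * v).
have actE v x : act v (c x) = c (x * v).
  by apply/cP; rewrite mulgKA; apply/cP.
have act_inj v : injective (act v).
  move=> t u; rewrite -(repK t) -(repK u) !actE => /cP; rewrite mulgKA.
  by move=> /cP.
pose f v := perm (act_inj v).
have fM : {morph f : x y / x * y}.
  by move=> x y; apply/permP => t; rewrite permM !permE -(repK t) !actE mulgA.
exists {perm T}, f; split; last first.
  move=> x fx1; have := congr1 (fun p : {perm T} => p (c 1)) fx1.
  by rewrite permE perm1 actE => /cP; rewrite mul1g invg1 mulg1.
split=> //; suff : \forall v \near (1 : G), [set: G] `<=` [set x | c (x * v) = c x].
  apply: filterS => v cv; apply/permP => t; rewrite permE perm1 -{1}(repK t).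
  by rewrite actE cv // repK.
have /compact_near_coveringP cov := cG.
apply: (cov _ _ (fun v x => c (x * v) = c x)) => x _.
have : \forall y \near x & v \near (1 : G), S (y * x^-1) /\ S (y * v * x^-1).
  apply: filterI.
    exists ([set y | S (y * x^-1)], setT) => /=; last by case=> u v [].
    split; last exact: filterT.
    by apply: nbhs_mulr; rewrite mulgV; apply: open_nbhs_nbhs; split => //; exact: subgroup1.
  apply: (@nbhs_mul G x 1 [set y | S (y * x^-1)]); rewrite mulg1.
  by apply: nbhs_mulr; rewrite mulgV; apply: open_nbhs_nbhs; split => //; exact: subgroup1.
by apply: filterS => -[y v] /= [/cP -> /cP ->].
Qed.

(** The finite quotients of a profinite group separate 1 from the complement of
    each of its neighbourhoods; this is how the profinite hypothesis is used. *)
Lemma profinite_finite_hom (U : set G) : profinite_group G -> nbhs 1 U ->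
  exists (R : finGroupType) (f : G -> R),
    finite_hom f /\ forall x, f x = 1 -> U x.
Proof.
move=> [cG hG tG] U1.
have [C [C1 clC] CU] := zero_dimensional_cvg hG
  (totally_disconnected_zero_dimensional cG hG tG) cG U1.
have [S [Sg oS SC]] := clopen_open_subgroup cG clC C1.
have [R [f [fh fS]]] := open_subgroup_finite_hom cG Sg oS.
by exists R, f; split=> // x /fS/SC/CU.
Qed.

End SmallHoms.

(** * Embedding problems and stages *)

Lemma is_subgroupT (G : topologicalGroupType) : is_subgroup [set: G].
Proof. by apply: is_subgroupP. Qed.

Section FiniteImages.
Context (G : topologicalGroupType) (R : finGroupType) (f : G -> R).

Definition image_set (S : set G) : {set R} :=
  [set a | `[< exists2 x, S x & f x = a >]].

Lemma image_setP (S : set G) a :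
  reflect (exists2 x, S x & f x = a) (a \in image_set S).
Proof. by rewrite inE; exact: asboolP. Qed.

Hypothesis f_hom : finite_hom f.

Lemma image_group_set (S : set G) : is_subgroup S -> group_set (image_set S).
Proof.
move=> Sg; apply/group_setP; split.
  by apply/image_setP; exists 1; [exact: subgroup1|exact: finite_hom1].
move=> _ _ /image_setP[x Sx <-] /image_setP[y Sy <-]; apply/image_setP.
by exists (x * y); [exact: subgroupM|exact: finite_homM].
Qed.

End FiniteImages.

Lemma imset_group_set (A B : finGroupType) (h : B -> A) (D : {group B}) :
  {morph h : x y / x * y} -> group_set (h @: D).
Proof.
move=> hM; apply/group_setP; split.
  have h1 : h 1 = 1 by apply: (mulgI (h 1)); rewrite -hM !mulg1.
  by rewrite -h1 imset_f.
move=> _ _ /imsetP[x Dx ->] /imsetP[y Dy ->].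
by rewrite -hM imset_f // groupM.
Qed.

Lemma preimset_group_set (A B : finGroupType) (h : B -> A) (D : {group A}) :
  {morph h : x y / x * y} -> group_set (h @^-1: D).
Proof.
move=> hM; apply/group_setP; split.
  have h1 : h 1 = 1 by apply: (mulgI (h 1)); rewrite -hM !mulg1.
  by rewrite inE h1.
by move=> x y; rewrite !inE hM => Dx Dy; rewrite groupM.
Qed.

(** The surjection of the embedding problem is the restriction of h to D, so
    that subgroups of a product can serve as its source. *)
Definition embedding_solvable (G : topologicalGroupType) : Prop :=
  forall (A B : finGroupType) (q : G -> A) (h : B -> A) (D : {group B}),
    finite_hom q -> {morph h : x y / x * y} -> h @: D = image_set q setT ->
    exists p : G -> B,
      [/\ finite_hom p, forall x, h (p x) = q x & image_set p setT = D].

Section Stages.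
Context (G : topologicalGroupType).

(** A finite quotient, the image of stage_hom, with the images of a future basis. The
    generators are a sequence, trivial from stage_rank on, because the basis
    elements that are added later have to be trivial in this quotient. *)
Record stage := Stage {
  stage_group : finGroupType;
  stage_hom : G -> stage_group;
  stage_gen : nat -> stage_group;
  stage_rank : nat
}.

(** The last clause says that the generators generate the image of stage_hom. *)
Definition stage_ok (S : stage) : Prop :=
  [/\ finite_hom (@stage_hom S),
      forall i, stage_rank S <= i -> stage_gen S i = 1,
      forall i, exists x, stage_hom S x = stage_gen S i &
      forall K : {group stage_group S},
        (forall i, stage_gen S i \in K) -> forall x, stage_hom S x \in K].

Definition refines (S' S : stage) : Prop :=
  exists2 h : stage_group S' -> stage_group S, {morph h : x y / x * y} &
    (forall x, h (stage_hom S' x) = stage_hom S x) /\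
    (forall i, h (stage_gen S' i) = stage_gen S i).

Definition realizes (S : stage) (r : nat) (P : finGroupType) (l : nat -> P) : Prop :=
  exists2 h : stage_group S -> P, {morph h : x y / x * y} &
    forall i, h (stage_gen S i) = if i < r then l i else 1.

Lemma refines_trans S1 S2 S3 : refines S1 S2 -> refines S2 S3 -> refines S1 S3.
Proof.
move=> [h hM [hh hg]] [h' h'M [h'h h'g]]; exists (h' \o h) => [x y /=|].
  by rewrite hM h'M.
by split=> [x|i] /=; [rewrite hh h'h|rewrite hg h'g].
Qed.

Lemma refines_realizes S' S r (P : finGroupType) (l : nat -> P) :
  refines S' S -> realizes S r l -> realizes S' r l.
Proof.
move=> [h hM [_ hg]] [k kM kg]; exists (k \o h) => [x y /=|i /=].
  by rewrite hM kM.
by rewrite hg kg.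
Qed.

(** The subgroup of the product generated by the pairs (generator, value)
    projects onto the image of stage_hom. A surjective solution of this
    embedding problem has these pairs as its generators, and the second
    projection realizes the values. *)
Lemma realize_values (S : stage) (P : finGroupType) (l : nat -> P) :
  embedding_solvable G -> stage_ok S ->
  exists S', [/\ stage_ok S', refines S' S, stage_rank S' = stage_rank S &
    realizes S' (stage_rank S) l].
Proof.
case: S => A q s r EP [qh s1 sim sgen]; rewrite /= in qh s1 sim sgen *.
pose s' i : (A * P)%type := (s i, if i < r then l i else 1).
pose D := <<[set s' i | i : 'I_r]>>%G.
have s'D i : s' i \in D.
  have [ir|ri] := ltnP i r; last by rewrite /s' s1 // ltnNge ri group1.
  by rewrite mem_gen //; apply/imsetP; exists (Ordinal ir).
have fstM : {morph (@fst A P) : x y / x * y} by [].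
have sndM : {morph (@snd A P) : x y / x * y} by [].
have DE : fst @: D = image_set q setT.
  apply/eqP; rewrite finset.eqEsubset; apply/andP; split.
    have Qg := image_group_set qh (is_subgroupT G).
    rewrite sub_imset_pre; have Pg := @preimset_group_set _ _ fst (Group Qg) fstM.
    suff : D \subset Group Pg by [].
    rewrite gen_subG.
    apply/fintype.subsetP => _ /imsetP[i _ ->]; rewrite inE /=.
    by apply/image_setP; have [x xE] := sim i; exists x.
  apply/fintype.subsetP => _ /image_setP[x _ <-].
  apply: (sgen (Group (imset_group_set D fstM))) => i /=.
  by apply/imsetP; exists (s' i).
have [p [ph pq pD]] := EP _ _ _ _ _ qh fstM DE.
exists (@Stage (A * P)%type p s' r); split=> //=.
- split=> //= [i ri|i|K sK x].
  + by rewrite /s' s1 // ltnNge ri.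
  + have : s' i \in gval D by exact: s'D.
    by rewrite -pD => /image_setP[x _ <-]; exists x.
  + have : p x \in gval D by rewrite -pD; apply/image_setP; exists x.
    apply: (fintype.subsetP _) => //; rewrite gen_subG.
    by apply/fintype.subsetP => _ /imsetP[i _ ->].
- by exists fst.
- by exists snd.
Qed.

Lemma finite_hom_pair (A P : finGroupType) (q : G -> A) (f : G -> P) :
  finite_hom q -> finite_hom f -> finite_hom (fun x => (q x, f x) : (A * P)%type).
Proof.
move=> [qM q1] [fM f1]; split; first by move=> x y; rewrite qM fM.
by apply: filterS (filterI q1 f1) => x [/= -> ->].
Qed.

(** Adding f to the quotient enlarges it by a kernel. The old generators are
    lifted arbitrarily, and all elements of the kernel are added as generators;
    these become trivial in the old quotient, as they must. *)
Lemma refine_hom (S : stage) (P : finGroupType) (f : G -> P) :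
  finite_hom f -> stage_ok S ->
  exists S', [/\ stage_ok S', refines S' S, stage_rank S < stage_rank S' &
    forall x, stage_hom S' x = 1 -> f x = 1].
Proof.
move=> fh; case: S => A q s r [qh s1 sim sgen]; rewrite /= in qh s1 sim sgen *.
pose q' x : (A * P)%type := (q x, f x).
have q'h : finite_hom q' by exact: finite_hom_pair.
pose E := enum [set b in image_set q' setT | b.1 == 1].
have [lift liftP] := choice sim.
pose s' i := if i < r then q' (lift i) else nth 1 E (i - r).
have Eim i : nth 1 E i \in [set b in image_set q' setT | b.1 == 1].
  have [iE|Ei] := ltnP i (size E); first by rewrite -mem_enum mem_nth.
  rewrite nth_default // inE eqxx andbT; apply/image_setP.
  by exists 1 => //; exact: finite_hom1.
have s's i : (s' i).1 = s i.
  rewrite /s'; case: ltnP => [|ri]; first by rewrite /= liftP.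
  by have := Eim (i - r); rewrite inE => /andP[_ /eqP ->]; rewrite s1.
have s'im i : s' i \in image_set q' setT.
  rewrite /s'; case: ltnP => _; first by apply/image_setP; exists (lift i).
  by have := Eim (i - r); rewrite inE => /andP[].
exists (@Stage (A * P)%type q' s' (r + (size E).+1)); split=> //=.
- split=> //= [i ri|i|K sK x].
  (* one generator more than the kernel has elements: the rank grows strictly *)
  + have ri' : r <= i by apply: leq_trans ri; exact: leq_addr.
    rewrite /s' ltnNge ri' /= nth_default // ltnW //.
    by rewrite -(leq_add2l r) subnKC.
  + by have /image_setP[x _ <-] := s'im i; exists x.
  + pose Q := Group (image_group_set q'h (is_subgroupT G)).
    have fstM : {morph (@fst A P) : x y / x * y} by [].
    have : q x \in Group (imset_group_set (K :&: Q)%G fstM).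
      apply: sgen => i /=; apply/imsetP; exists (s' i) => //.
      by rewrite inE sK s'im.
    move=> /imsetP[b /finset.setIP[Kb /image_setP[y _ yb]] qx].
    have q'xy : q' (x * y^-1) \in K.
      have : q' (x * y^-1) \in E.
        rewrite mem_enum inE; apply/andP; split.
          by apply/image_setP; exists (x * y^-1).
        rewrite /= (finite_homM qh) (finite_homV qh) qx -yb /=.
        by rewrite mulgV.
      move=> /(nthP 1)[j jE <-]; have := sK (r + j).
      by rewrite /s' ltnNge leq_addr /= addKn.
    by rewrite -(mulgVK y x) (finite_homM q'h) groupM // yb.
- by exists fst.
- by rewrite -addSnnS leq_addr.
- by move=> x [].
Qed.

Lemma refine_stage (S : stage) (P P' : finGroupType) (l : nat -> P) (f : G -> P') :
  embedding_solvable G -> finite_hom f -> stage_ok S ->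
  exists S', [/\ stage_ok S', refines S' S, stage_rank S < stage_rank S',
    realizes S' (stage_rank S) l &
    forall x, stage_hom S' x = 1 -> f x = 1].
Proof.
move=> EP fh Sok; have [S1 [S1ok S1S <- S1l]] := realize_values l EP Sok.
have [S2 [S2ok S2S1 rlt S2f]] := refine_hom fh S1ok.
exists S2; split=> //; first exact: refines_trans S1S.
exact: refines_realizes S1l.
Qed.

End Stages.

(** * Iwasawa's criterion *)

Lemma compact_nested_nonempty (T : topologicalType) (C : nat -> set T) :
  compact [set: T] -> (forall n, closed (C n)) -> (forall n, C n !=set0) ->
  (forall n, C n.+1 `<=` C n) -> \bigcap_n C n !=set0.
Proof.
move=> cT clC C0 decC; apply: contrapT => cap0.
have mono m n : m <= n -> C n `<=` C m.
  move=> /subnKC <-; elim: (n - m) => [|k IH]; first by rewrite addn0.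
  by rewrite addnS; apply: (subset_trans (decC _)).
have dirC i j : setT i -> setT j -> exists2 k, setT k & C k `<=` C i `&` C j.
  move=> _ _; exists (maxn i j) => // x Cx.
  by split; apply: (mono _ (maxn i j)) Cx; rewrite ?leq_maxl ?leq_maxr.
have sub : \bigcap_n C n `<=` set0 by move=> x Cx; case: cap0; exists x.
have nat0 : [set: nat] !=set0 by exists 0%N.
have [i _ Ci] := compact_filtered_subset cT nat0 (fun i _ => clC i) dirC open0 sub.
by have [x /Ci] := C0 i.
Qed.

Lemma dense_fibre (G : topologicalGroupType) (R : finGroupType) (f : G -> R)
    (S : set G) (y : G) :
  finite_hom f -> dense S -> exists2 x, S x & f x = f y.
Proof.
move=> fh dS; have [||x [/= fx Sx]] := dS (f @^-1` [set f y]); first by exists y.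
  exact: finite_hom_open.
by exists x.
Qed.

Lemma generates_image (G : topologicalGroupType) (R : finGroupType) (f : G -> R)
    (X : set G) (K : {group R}) :
  finite_hom f -> generates X -> (forall x, X x -> f x \in K) ->
  forall x, f x \in K.
Proof.
move=> fh gX XK x; have [y gy <-] := dense_fibre x fh gX.
apply: (gy [set z | f z \in K]); split=> //=; apply: is_subgroupP => [|u v /= fu fv].
  by rewrite /= (finite_hom1 fh) group1.
by rewrite (finite_homM fh) (finite_homV fh) groupM ?groupV.
Qed.

(** Cayley's theorem, with symmetric groups of ordinals as targets: there are
    countably many of these, so that they can be enumerated. *)
Lemma perm_embedding (L : finGroupType) :
  exists2 c : L -> 'S_#|L|, {morph c : x y / x * y} & injective c.
Proof.
have inj (a : L) : injective (fun j : 'I_#|L| => enum_rank (enum_val j * a)).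
  by move=> i j /enum_rank_inj /mulIg /enum_val_inj.
exists (fun a => perm (inj a)) => [a b|a b ab].
  by apply/permP => j; rewrite permM !permE enum_rankK mulgA.
have := congr1 (fun p : 'S_#|L| => p (enum_rank 1)) ab.
by rewrite !permE => /enum_rank_inj; rewrite !enum_rankK !mul1g.
Qed.

Lemma injective_unbounded (f : nat -> nat) (N : nat) :
  injective f -> exists j, N <= f j.
Proof.
move=> finj; apply: contrapT => nex.
have fN j : f j < N by rewrite ltnNge; apply/negP => Nfj; apply: nex; exists j.
have /leq_card : injective (fun i : 'I_N.+1 => Ordinal (fN i)).
  by move=> i j /(congr1 val)/= /finj ij; exact: val_inj.
by rewrite !card_ord ltnn.
Qed.

(** A finite list of values in a symmetric group, to be taken by the first
    elements of the basis. *)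
Definition task : countType := {k : nat & seq 'S_k}.

(** An enumeration of the tasks in which each one recurs infinitely often, thus
    also at stages whose rank exceeds the length of its list. *)
Definition task_at (n : nat) : task :=
  if (unpickle n : option (task * nat)%type) is Some u then u.1
  else existT _ 0%N [::].

Lemma task_at_ge (t : task) (N : nat) : exists2 n, N <= n & task_at n = t.
Proof.
have [|j Nj] := @injective_unbounded (fun j => pickle (t, j)) N.
  by move=> i j /(pcan_inj pickleK) [].
by exists (pickle (t, j)); rewrite // /task_at pickleK.
Qed.

Section Iwasawa.
Context (G : topologicalGroupType).
Context (cG : compact [set: G]) (EP : embedding_solvable G).
Context (R : nat -> finGroupType) (f : forall n, G -> R n).
Hypothesis f_hom : forall n, finite_hom (f n).
Hypothesis f_cofinal : forall U : set G, nbhs 1 U ->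
  exists n, forall x, f n x = 1 -> U x.

(* the f n play the role of a countable basis of open normal subgroups *)
Let task_values n (i : nat) : 'S_(projT1 (task_at n)) := nth 1 (projT2 (task_at n)) i.

Lemma stage_sequence : exists S : nat -> stage G,
  forall n, [/\ stage_ok (S n), refines (S n.+1) (S n),
    stage_rank (S n) < stage_rank (S n.+1),
    realizes (S n.+1) (stage_rank (S n)) (task_values n) &
    forall x, stage_hom (S n.+1) x = 1 -> f n x = 1].
Proof.
pose S0 := @Stage G 'S_0 (fun=> 1) (fun=> 1) 0.
have S0ok : stage_ok S0.
  split=> //=; first by split=> [x y|]; [rewrite mulg1|exact: filterE].
  by move=> i; exists 1.
pose okst := {S : stage G | stage_ok S}.
have next n (S : okst) : {S' : okst | [/\ refines (sval S') (sval S),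
    stage_rank (sval S) < stage_rank (sval S'),
    realizes (sval S') (stage_rank (sval S)) (task_values n) &
    forall x, stage_hom (sval S') x = 1 -> f n x = 1]}.
  apply: cid.
  have [S' [ok' h1 h2 h3 h4]] := refine_stage (task_values n) EP (f_hom n) (svalP S).
  by exists (exist _ S' ok').
pose S := fix S n : okst := if n is m.+1 then sval (next m (S m)) else exist _ S0 S0ok.
exists (fun n => sval (S n)) => n; split; first exact: svalP.
- by have [] := svalP (next n (S n)).
- by have [] := svalP (next n (S n)).
- by have [] := svalP (next n (S n)).
- by have [] := svalP (next n (S n)).
Qed.

(** By compactness there are elements X i of G that map to the i-th generator
    of every stage. They converge to 1, since each stage has only finitely many
    nontrivial generators; they generate because the generators do; and each finite list of values is
    realized at some stage. Distinctness follows from the last property. *)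
Theorem embedding_solvable_basis :
  exists X : nat -> G, injective X /\ profinite_basis (range X).
Proof.
have [S SP] := stage_sequence.
have Sok n : stage_ok (S n) by have [] := SP n.
have Shom n : finite_hom (@stage_hom _ (S n)) by have [] := Sok n.
have rank_ge n : n <= stage_rank (S n).
  by elim: n => // n IH; have [_ _ lt _ _] := SP n; exact: leq_ltn_trans lt.
have limit i : exists x, forall n, stage_hom (S n) x = stage_gen (S n) i.
  have [|||x Cx] := @compact_nested_nonempty G
    (fun n => [set x | stage_hom (S n) x = stage_gen (S n) i]) cG.
  - move=> n; have -> : [set x | stage_hom (S n) x = stage_gen (S n) i] =
      ~` (@stage_hom _ (S n) @^-1` [set~ stage_gen (S n) i]).
      by apply/seteqP; split=> x /=; [move=> + ne; apply: ne|exact: contrapT].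
    by apply: open_closedC; exact: finite_hom_open.
  - by move=> n; have [_ _ /(_ i)] := Sok n.
  - move=> n x /= xE; have [_ [h _ [hh hg]] _ _ _] := SP n.
    by rewrite -hh xE hg.
  - by exists x => n; exact: Cx.
have [X XE] := choice limit.
(* the sequence f makes the kernels of the stages a basis at 1 *)
have kernel_small U : nbhs 1 U -> exists n, forall x, stage_hom (S n) x = 1 -> U x.
  move=> /f_cofinal[n fU]; exists n.+1 => x Sx1; apply: fU.
  by have [_ _ _ _] := SP n; apply.
(* at a late recurrence of the task, the rank exceeds the length of its list, so
   that no value is cut off *)
have values (t : task) : exists2 g : G -> 'S_(projT1 t), finite_hom g &
    forall i, g (X i) = nth 1 (projT2 t) i.
  have [n nt tn] := task_at_ge t (size (projT2 t)); subst t.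
  have [_ _ _ [h hM hg] _] := SP n.
  have h1 : h 1 = 1 by apply: (mulgI (h 1)); rewrite -hM !mulg1.
  exists (h \o @stage_hom _ (S n.+1)).
    split=> [x y /=|]; first by rewrite (finite_homM (Shom _)) hM.
    by apply: filterS (Shom n.+1).2 => x /= ->.
  move=> i /=; rewrite XE hg; case: ltnP => // ri.
  by rewrite /task_values nth_default // (leq_trans nt) // (leq_trans _ ri).
have X_inj : injective X.
  move=> i j Xij; apply: contrapT => /eqP ij.
  pose a : 'S_2 := tperm ord0 ord_max.
  have a1 : a != 1.
    by apply/eqP => /permP/(_ ord0); rewrite perm1 tpermL.
  have [g _ gX] := values (existT _ 2 (set_nth 1 [::] i a)).
  have := gX i; rewrite Xij gX /= !nth_set_nth /= eqxx eq_sym (negPf ij).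
  by rewrite nth_nil => a1'; rewrite -a1' eqxx in a1.
have gX : generates (range X).
  move=> O [y Oy] oO.
  have [n nO] : exists n, forall x, stage_hom (S n) x = 1 -> O (y * x).
    apply: (kernel_small [set x | O (y * x)]); apply: nbhs_mull; rewrite mulg1.
    exact: open_nbhs_nbhs.
  have gg : is_subgroup (generated_subgroup (range X)).
    apply: is_subgroupP => [K [Kg _]|u v gu gv K KX]; first exact: subgroup1.
    by apply: subgroupM; [exact: KX.1|exact: gu|apply: subgroupV; [exact: KX.1|exact: gv]].
  have [_ _ _ gen] := Sok n.
  have : stage_hom (S n) y \in Group (image_group_set (Shom n) gg).
    apply: gen => i; apply/image_setP; exists (X i); last by rewrite XE.
    by move=> K [_]; apply; exists i.
  move=> /image_setP[z gz zy]; exists z; split=> //.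
  rewrite -(mulVKg y z); apply: nO.
  by rewrite (finite_homM (Shom n)) (finite_homV (Shom n)) zy mulVg.
exists X; split=> //; split=> //.
- move=> U Ug oU.
  have [|n nU] := kernel_small U.
    by apply: open_nbhs_nbhs; split=> //; exact: subgroup1.
  apply: (@sub_finite_set _ _ (X @` `I_(stage_rank (S n)))); last exact: finite_image.
  move=> _ [[i _ <-] nUi]; exists i => //=; rewrite ltnNge; apply/negP => ri.
  by apply: nUi; apply: nU; rewrite XE; have [_ -> ] := Sok n.
- move=> L alpha fin.
  have [N NP] : exists N, forall i, N <= i -> alpha (X i) = 1.
    have finI : finite_set [set i | alpha (X i) <> 1].
      have := finite_preimage (in2W X_inj) fin.
      by apply: sub_finite_set => i /= ai; split=> //; exists i.
    have [s sE] := (finite_seqP _).1 finI.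
    exists (\max_(i <- s) i).+1 => i si; apply: contrapT => ai.
    have is_ : i \in s by have : [set` s] i by rewrite -sE.
    by move: si; rewrite ltnNge (@leq_bigmax_seq _ _ _ id i).
  have [c cM c_inj] := perm_embedding L.
  have c1 : c 1 = 1 by apply: (mulgI (c 1)); rewrite -cM !mulg1.
  have [g gh gl] := values (existT _ #|L| [seq c (alpha (X i)) | i <- iota 0 N]).
  have gcX i : g (X i) = c (alpha (X i)).
    rewrite gl /=; have [iN|Ni] := ltnP i N.
      by rewrite (nth_map 0%N) ?size_iota // nth_iota.
    by rewrite nth_default ?size_map ?size_iota // NP.
  (* the homomorphism lands in the Cayley image of L, since the X i do *)
  have gim x : g x \in Group (imset_group_set [group of [set: L]] cM).
    apply: (generates_image gh gX) => _ [i _ <-].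
    by apply/imsetP; exists (alpha (X i)).
  have {}gim x : exists a, c a = g x by have /imsetP[a _ ->] := gim x; exists a.
  have [F FP] := choice gim.
  have Fh : finite_hom F.
    split=> [x y|]; first by apply: c_inj; rewrite FP cM !FP (finite_homM gh).
    apply: filterS gh.2 => x gx1; apply: c_inj; by rewrite FP gx1 c1.
  pose FM : {multiplicative G -> L} := HB.pack F (isMultiplicative.Build G L F Fh.1).
  exists FM; split; first exact: finite_hom_continuous Fh.
  by move=> _ /set_mem[i _ <-]; apply: c_inj; rewrite /= FP gcX.
Qed.
End Iwasawa.

(** * Words and labelled coset graphs *)

Section Words.
Context (F : groupType).

(** An element with an exponent, 1 for true and -1 for false. Words are formal:
    x^-1 may coincide with another letter in the group. *)
Definition letter : Type := (F * bool)%type.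
Definition letter_val (a : letter) : F := if a.2 then a.1 else a.1^-1.
Definition letter_inv (a : letter) : letter := (a.1, ~~ a.2).
Definition word_val (w : seq letter) : F := foldr (fun a z => letter_val a * z) 1 w.
Definition word_inv (w : seq letter) : seq letter := rev (map letter_inv w).

Lemma letter_val_inv a : letter_val (letter_inv a) = (letter_val a)^-1.
Proof. by case: a => x [] //=; rewrite /letter_val /= invgK. Qed.

Lemma word_val_cat w1 w2 : word_val (w1 ++ w2) = word_val w1 * word_val w2.
Proof. by elim: w1 => [|a w IH] /=; rewrite ?mul1g // IH mulgA. Qed.

Lemma word_inv_cons a w : word_inv (a :: w) = word_inv w ++ [:: letter_inv a].
Proof. by rewrite /word_inv /= rev_cons cats1. Qed.

Lemma word_val_inv w : word_val (word_inv w) = (word_val w)^-1.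
Proof.
elim: w => [|a w IH]; first by rewrite /= invg1.
by rewrite word_inv_cons word_val_cat IH /= mulg1 letter_val_inv invMg.
Qed.

Definition word_in (X : set F) (w : seq letter) : Prop := forall a, a \in w -> X a.1.

Lemma word_in_cat X w1 w2 : word_in X w1 -> word_in X w2 -> word_in X (w1 ++ w2).
Proof. by move=> h1 h2 a; rewrite mem_cat => /orP[/h1|/h2]. Qed.

Lemma word_in_inv X w : word_in X w -> word_in X (word_inv w).
Proof.
elim: w => [|a w IH] // wX; rewrite word_inv_cons; apply: word_in_cat.
  by apply: IH => b bw; apply: wX; rewrite inE bw orbT.
by move=> b; rewrite inE => /eqP ->; apply: (wX a); rewrite inE eqxx.
Qed.

End Words.

Lemma generated_subgroup_word (F : topologicalGroupType) (X : set F) x :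
  generated_subgroup X x -> exists2 w, word_in X w & word_val w = x.
Proof.
move=> /(_ [set x | exists2 w, word_in X w & word_val w = x]); apply; split=> /=.
  apply: is_subgroupP; first by exists [::].
  move=> _ _ [w wX <-] [w' w'X <-]; exists (w ++ word_inv w').
    by apply: word_in_cat => //; exact: word_in_inv.
  by rewrite word_val_cat word_val_inv.
move=> y Xy; exists [:: (y, true)]; last by rewrite /= mulg1.
by move=> b; rewrite inE => /eqP ->.
Qed.

Section Labels.
Context (F : topologicalGroupType) (R B : finGroupType) (rho : F -> R).
Hypothesis rho_hom : finite_hom rho.
Implicit Types (V : {set R}) (a : letter F) (w : seq (letter F)).

Definition act V a : {set R} := V :* rho (letter_val a).
(** The origin of the positively oriented edge crossed by the letter a from the
    vertex V; it names the edge independently of the direction. *)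
Definition tail V a : {set R} := if a.2 then V else act V a.

Definition label (c : {set R} -> F -> B) V a : B :=
  if a.2 then c V a.1 else (c (tail V a) a.1)^-1.

Fixpoint path_label c V w : B :=
  if w is a :: w' then label c V a * path_label c (act V a) w' else 1.

Lemma act_inv V a : act (act V a) (letter_inv a) = V.
Proof.
by rewrite /act letter_val_inv (finite_homV rho_hom) -rcosetM mulgV rcoset1.
Qed.

Lemma tail_inv V a : tail (act V a) (letter_inv a) = tail V a.
Proof. by rewrite /tail act_inv; case: a => x []. Qed.

Lemma label_inv c V a : label c (act V a) (letter_inv a) = (label c V a)^-1.
Proof.
rewrite /label tail_inv; case: a => x [] //=.
by rewrite invgK.
Qed.

Lemma path_label_cat c V w1 w2 :
  path_label c V (w1 ++ w2) =
  path_label c V w1 * path_label c (V :* rho (word_val w1)) w2.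
Proof.
elim: w1 V => [|a w IH] V /=; first by rewrite mul1g (finite_hom1 rho_hom) rcoset1.
by rewrite IH mulgA /act (finite_homM rho_hom) rcosetM.
Qed.

Lemma path_label_inv c V w :
  path_label c (V :* rho (word_val w)) (word_inv w) = (path_label c V w)^-1.
Proof.
elim: w V => [|a w IH] V /=; first by rewrite invg1.
rewrite word_inv_cons path_label_cat (finite_homM rho_hom) rcosetM IH /= mulg1.
rewrite invMg; congr (_ * _); rewrite -label_inv; congr (label c _ _).
by rewrite word_val_inv (finite_homV rho_hom) -rcosetM mulgV rcoset1.
Qed.

Context (J : {group R}) (X : set F).
Hypothesis gX : generates X.
Hypothesis X_hom : forall (L : finGroupType) (alpha : F -> L),
  exists f : F -> L, finite_hom f /\ forall x, X x -> f x = alpha x.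

(** Whatever the labels, each x in X acts on R x B by a permutation, so freeness
    makes F act. The vertex that matters is the coset of the first coordinate,
    but taking all of R there makes the action visibly bijective. *)
Lemma labelled_action (c : {set R} -> F -> B) :
  exists f : F -> {perm (R * B)%type}, finite_hom f /\
    forall w, word_in X w -> forall r b,
      f (word_val w) (r, b) =
      (r * rho (word_val w), b * path_label c (J :* r) w).
Proof.
pose step x (u : R * B) : R * B := (u.1 * rho x, u.2 * c (J :* u.1) x).
have step_inj x : injective (step x).
  by move=> [r b] [r' b'] [/mulIg -> /mulIg ->].
have [f [fh fX]] := X_hom (fun x => perm (step_inj x)).
have fletter a : X a.1 -> forall r b, f (letter_val a) (r, b) =
    (r * rho (letter_val a), b * label c (J :* r) a).
  case: a => x [] /= Xx r b; rewrite /letter_val /label /=; first by rewrite fX // permE.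
  rewrite (finite_homV fh) fX //; apply: (@perm_inj _ (perm (step_inj x))).
  rewrite permKV permE /step /= /tail /act /letter_val /= -rcosetM.
  by rewrite (finite_homV rho_hom) !mulgVK.
exists f; split=> //; elim=> [|a w IH] wX r b /=.
  by rewrite (finite_hom1 fh) perm1 (finite_hom1 rho_hom) !mulg1.
rewrite (finite_homM fh) permM fletter; last by apply: wX; rewrite inE eqxx.
rewrite IH; last by move=> d dw; apply: wX; rewrite inE dw orbT.
by rewrite (finite_homM rho_hom) !mulgA /act rcosetM.
Qed.

(** The second coordinate of the orbit of (1, 1). It is multiplicative where the
    left factor returns to the vertex J, because labels depend only on the
    coset. Approximating elements of F by words reduces everything to paths. *)
Lemma label_cocycle (c : {set R} -> F -> B) :
  exists p : F -> B, [/\ \forall y \near (1 : F), p y = 1,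
    forall x y, rho x \in J -> p (x * y) = p x * p y,
    forall y, exists2 w, word_in X w &
      rho (word_val w) = rho y /\ p y = path_label c J w &
    forall w, word_in X w -> p (word_val w) = path_label c J w].
Proof.
have [f [fh fw]] := labelled_action c.
pose p y := (f y (1, 1)).2.
have pw w : word_in X w -> p (word_val w) = path_label c J w.
  by move=> wX; rewrite /p fw //= mul1g rcoset1.
have approx y : exists2 w, word_in X w & rho (word_val w) = rho y /\ f (word_val w) = f y.
  have [_ /generated_subgroup_word[w wX <-] [fE rE]] :=
    dense_fibre y (finite_hom_pair fh rho_hom) gX.
  by exists w.
exists p; split=> //.
- by apply: filterS fh.2 => y fy1; rewrite /p fy1 perm1.
- move=> x y Jx; have [w wX [rw fwE]] := approx x; have [v vX [rv fvE]] := approx y.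
  have -> : p x = p (word_val w) by rewrite /p fwE.
  have -> : p y = p (word_val v) by rewrite /p fvE.
  have -> : p (x * y) = p (word_val (w ++ v)).
    by rewrite /p word_val_cat !(finite_homM fh) fwE fvE.
  by rewrite !pw ?path_label_cat ?rw ?rcoset_id //; exact: word_in_cat.
- by move=> y; have [w wX [rw fwE]] := approx y; exists w; rewrite // -pw // /p fwE.
Qed.

End Labels.

(** * Labels with prescribed values on disjoint cycles *)

(** The hypotheses say that the word a :: u runs through simple closed paths at
    the vertices V p, and that these paths are pairwise disjoint. *)
Section Rerouting.
Context (F : topologicalGroupType) (R : finGroupType) (rho : F -> R).
Hypothesis rho_hom : finite_hom rho.
Context (J : {group R}) (X : set F) (I : finType) (V : I -> {set R}).
Context (a : letter F) (u : seq (letter F)).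
Hypotheses (aX : X a.1) (uX : word_in X u).
Hypothesis loop : forall p, V p :* rho (word_val (a :: u)) = V p.
Hypothesis V_inj : injective V.
Hypothesis interior_start : forall p p' i, i < size u ->
  act rho (V p) a :* rho (word_val (take i u)) <> V p'.
Hypothesis interior_next : forall p p' i, i < size u ->
  act rho (V p) a :* rho (word_val (take i u)) = act rho (V p') a -> i = 0.
Hypothesis reduced : forall u', u <> letter_inv a :: u'.

Local Notation act := (act rho).
Local Notation tail := (tail rho).

(** The first edge of one of the cycles, crossed in either direction. *)
Definition marked W (b : letter F) : bool :=
  [exists p, (b.1 == a.1) && (tail W b == tail (V p) a)].

Fixpoint avoids W (w : seq (letter F)) : bool :=
  if w is b :: w' then ~~ marked W b && avoids (act W b) w' else true.

Lemma act_inj b : injective (act^~ b).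
Proof. by move=> W W' WW'; rewrite -(act_inv rho_hom W b) WW' (act_inv rho_hom). Qed.

Lemma letter_invK : involutive (@letter_inv F).
Proof. by case=> x [] //. Qed.

Lemma markedP W b : marked W b ->
  exists p, (b = a /\ W = V p) \/ (b = letter_inv a /\ W = act (V p) a).
Proof.
move=> /existsP[p /andP[/eqP b1 /eqP tE]]; exists p.
have [b2|b2] := eqVneq b.2 a.2.
  have ba : b = a by case: b a b1 b2 {tE} => ? ? [? ?] /= -> ->.
  left; split=> //; move: tE; rewrite ba /tail; case: a.2 => //; exact: act_inj.
have ba : b = letter_inv a.
  by rewrite /letter_inv; case: b a b1 b2 {tE} => x [] [y []] //= -> _.
right; split=> //; move: tE; rewrite ba /tail /=; case: (a.2) => //=.
by move=> <-; rewrite -{2}[a]letter_invK act_inv.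
Qed.

Lemma marked_inv W b : marked (act W b) (letter_inv b) = marked W b.
Proof. by rewrite /marked tail_inv. Qed.

Lemma avoids_cat W w1 w2 :
  avoids W (w1 ++ w2) = avoids W w1 && avoids (W :* rho (word_val w1)) w2.
Proof.
elim: w1 W => [|b w IH] W /=; first by rewrite (finite_hom1 rho_hom) rcoset1.
by rewrite IH andbA /act (finite_homM rho_hom) rcosetM.
Qed.

Lemma avoids_inv W w :
  avoids W w -> avoids (W :* rho (word_val w)) (word_inv w).
Proof.
elim: w W => [|b w IH] W //= /andP[sb /IH av].
rewrite word_inv_cons avoids_cat (finite_homM rho_hom) rcosetM av /= andbT.
rewrite word_val_inv (finite_homV rho_hom) -[_ :* _ :* _ :* _]rcosetM mulgV rcoset1.
by rewrite marked_inv.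
Qed.

(** A later step of the cycle starts at none of the V p', and it starts at the
    second vertex of a cycle only if it is the very next step of the same cycle;
    going back along a is then excluded by reducedness. *)
Lemma loop_avoids p : avoids (act (V p) a) u.
Proof.
suff H w2 w1 : u = w1 ++ w2 -> avoids (act (V p) a :* rho (word_val w1)) w2.
  by have := H u [::] erefl; rewrite /= (finite_hom1 rho_hom) rcoset1.
elim: w2 w1 => [|b w2 IH] w1 //= uE; apply/andP; split; last first.
  have := IH (rcons w1 b); rewrite cat_rcons => /(_ uE).
  by rewrite -cats1 word_val_cat /= mulg1 (finite_homM rho_hom) rcosetM.
have w1u : size w1 < size u by rewrite uE size_cat /= addnS ltnS leq_addr.
have w1E : w1 = take (size w1) u by rewrite uE take_size_cat.
apply/negP => /markedP[p' [[_ WV]|[ba WV]]].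
  by apply: (interior_start w1u (p := p) (p' := p')); rewrite -w1E.
have := @interior_next p p' _ w1u; rewrite -w1E => /(_ WV)/size0nil w10.
by apply: (@reduced w2); rewrite uE w10 ba.
Qed.

(** Whenever a path is about to cross a marked edge, it can walk around the rest
    of that cycle instead. *)
Lemma avoiding_word w : word_in X w -> exists v, [/\ word_in X v, avoids J v &
  J :* rho (word_val v) = J :* rho (word_val w)].
Proof.
elim/last_ind: w => [|w b IH] wX; first by exists [::].
have [|v [vX av vE]] := IH; first by move=> d dw; apply: wX; rewrite mem_rcons inE dw orbT.
have bX : X b.1 by apply: wX; rewrite mem_rcons inE eqxx.
rewrite -cats1 word_val_cat (finite_homM rho_hom) rcosetM -vE /= mulg1.
set W := J :* _ in vE *.
have [/markedP[p [[-> WV]|[-> WV]]]|sb] := boolP (marked W b).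
- exists (v ++ word_inv u); split.
  + by apply: word_in_cat => //; exact: word_in_inv.
  + rewrite avoids_cat av /= -/W WV -(loop p) /= (finite_homM rho_hom) rcosetM.
    exact: avoids_inv (loop_avoids p).
  + rewrite word_val_cat (finite_homM rho_hom) rcosetM -/W WV -{1}(loop p) /=.
    rewrite (finite_homM rho_hom) word_val_inv (finite_homV rho_hom) -!rcosetM.
    by rewrite mulgK.
- exists (v ++ u); split; first exact: word_in_cat.
  + by rewrite avoids_cat av /= -/W WV loop_avoids.
  + rewrite word_val_cat (finite_homM rho_hom) rcosetM -/W WV.
    rewrite -[LHS]/(act (V p) a :* rho (word_val u)) -rcosetM -(finite_homM rho_hom).
    by rewrite (loop p); apply/esym; exact: act_inv.
- exists (v ++ [:: b]); split.
  + by apply: word_in_cat => // d; rewrite inE => /eqP ->.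
  + by rewrite avoids_cat av /= -/W sb.
  + by rewrite word_val_cat (finite_homM rho_hom) rcosetM -/W /= mulg1.
Qed.

Context (A B : finGroupType) (h : B -> A) (D : {group B}) (t : R -> A).
Hypothesis gX : generates X.
Hypothesis X_hom : forall (L : finGroupType) (alpha : F -> L),
  exists f : F -> L, finite_hom f /\ forall x, X x -> f x = alpha x.
Hypothesis hM : {morph h : x y / x * y}.
Hypothesis tJ : forall j r, j \in J -> t (j * r) = t j * t r.
Hypothesis tD : forall r, t r \in h @: D.

Let h1 : h 1 = 1. Proof. by apply: (mulgI (h 1)); rewrite -hM !mulg1. Qed.
Let hV x : h x^-1 = (h x)^-1.
Proof. by apply: (mulgI (h x)); rewrite -hM !mulgV. Qed.
Let t1 : t 1 = 1. Proof. by apply: (mulgI (t 1)); rewrite -tJ // !mulg1. Qed.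

(** The map t is multiplicative on J and equivariant under it, so that
    (t r)^-1 * t (r * z) depends only on the coset of r. It is the element of A
    that the label of the edge from r to r * z has to lift. *)
Lemma slope_coset r s z : J :* r = J :* s -> (t r)^-1 * t (r * z) = (t s)^-1 * t (s * z).
Proof.
move=> rs; have /rcosetP[j Jj ->] : r \in J :* s by rewrite -rs rcoset_refl.
by rewrite -mulgA (tJ s Jj) (tJ _ Jj) invMg -!mulgA mulKg.
Qed.

Definition lifts_slopes (c : {set R} -> F -> B) : Prop :=
  (forall W x, c W x \in D) /\
  forall r x, h (c (J :* r) x) = (t r)^-1 * t (r * rho x).

Lemma path_label_in c w W : lifts_slopes c -> path_label rho c W w \in D.
Proof.
move=> [cD _]; elim: w W => [|b w IH] W /=; first exact: group1.
by rewrite groupM // /label; case: b.2; rewrite ?groupV.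
Qed.

Lemma path_label_slope c w r : lifts_slopes c ->
  h (path_label rho c (J :* r) w) = (t r)^-1 * t (r * rho (word_val w)).
Proof.
move=> [_ cs]; elim: w r => [|b w IH] r /=.
  by rewrite h1 (finite_hom1 rho_hom) mulg1 mulVg.
rewrite hM (_ : act _ b = J :* (r * rho (letter_val b))); last by rewrite rcosetM.
rewrite IH (finite_homM rho_hom) !mulgA; congr (_ * _).
suff -> : h (label rho c (J :* r) b) = (t r)^-1 * t (r * rho (letter_val b)).
  by rewrite mulgK.
rewrite /label /letter_val; case: b => x [] /=; first by rewrite cs.
rewrite /tail /= /act -rcosetM /letter_val /= (finite_homV rho_hom) hV cs mulgVK.
by rewrite invMg invgK.
Qed.

Lemma lifts_slopes_exist : exists c, lifts_slopes c.
Proof.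
have /choice[l lP] : forall e : A, exists b : B, b \in D /\ (e \in h @: D -> h b = e).
  move=> e; have [/imsetP[b Db ->]|eD] := boolP (e \in h @: D); first by exists b.
  by exists 1; split.
have hDg : group_set (h @: D) by exact: imset_group_set.
exists (fun W x => l ((t (repr W))^-1 * t (repr W * rho x))); split=> [W x|r x].
  by have [] := lP ((t (repr W))^-1 * t (repr W * rho x)).
have [_ ->] := lP ((t (repr (J :* r)))^-1 * t (repr (J :* r) * rho x)).
  apply: slope_coset; apply/esym/rcoset_eqP; rewrite rcoset_sym.
  by apply: mem_repr_rcoset.
by rewrite (groupM (G := Group hDg)) // (groupV (Group hDg)).
Qed.

(** The labels of the marked edges can be changed to any lifts; paths that avoid
    the marked edges keep their labels. *)
Lemma prescribe_labels c0 (beta : I -> B) : lifts_slopes c0 ->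
  (forall p, beta p \in D) ->
  (forall p, exists2 r, V p = J :* r &
     h (beta p) = (t r)^-1 * t (r * rho (letter_val a))) ->
  exists c, [/\ lifts_slopes c, forall p, label rho c (V p) a = beta p &
    forall w W, avoids W w -> path_label rho c W w = path_label rho c0 W w].
Proof.
move=> [c0D c0s] bD bs.
pose c W x := if [pick p | (x == a.1) && (W == tail (V p) a)] is Some p
  then (if a.2 then beta p else (beta p)^-1) else c0 W x.
exists c; split.
- split=> [W x|r x]; rewrite /c; case: pickP => [p|] //.
    by case: a.2; rewrite ?groupV.
  move=> /andP[/eqP -> /eqP rE]; have [s VE hb] := bs p.
  rewrite VE in rE; move: rE hb; rewrite /tail /act /letter_val.
  case: a.2 => [rs ->|]; first by rewrite (slope_coset _ rs).
  rewrite (finite_homV rho_hom) -rcosetM => rs hb.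
  by rewrite hV hb (slope_coset _ rs) invMg invgK mulgVK.
- move=> p; have cE : c (tail (V p) a) a.1 = if a.2 then beta p else (beta p)^-1.
    rewrite /c; case: pickP => [p0 /andP[_ /eqP tE]|/(_ p)]; last by rewrite !eqxx.
    suff -> : p = p0 by [].
    by apply: V_inj; move: tE; rewrite /tail; case: a.2 => // /act_inj.
  by move: cE; rewrite /label /tail; case: a.2 => ->; rewrite ?invgK.
- elim=> [|b w IH] W //= /andP[sb /IH ->]; congr (_ * _).
  have cE : c (tail W b) b.1 = c0 (tail W b) b.1.
    rewrite /c; case: pickP => // p /andP[b1 tE].
    by case/negP: sb; apply/existsP; exists p; rewrite b1.
  by move: cE; rewrite /label /tail; case: b.2 => ->.
Qed.

(** The points y p are values of words that reach the cycles without crossing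
    marked edges. They are chosen before the labels, so the values d p may
    depend on them. *)
Lemma prescribed_lift (g : I -> F) : (forall p, V p = J :* rho (g p)) ->
  exists y : I -> F, (forall p, rho (y p) \in V p) /\
  forall d : I -> B,
    (forall p, d p \in D) ->
    (forall p, rho (y p * word_val (a :: u) * (y p)^-1) \in J) ->
    (forall p, h (d p) = t (rho (y p * word_val (a :: u) * (y p)^-1))) ->
  exists f : F -> B, [/\ \forall x \near (1 : F), f x = 1,
    forall x y, rho x \in J -> f (x * y) = f x * f y,
    forall x, f x \in D,
    forall x, h (f x) = t (rho x) &
    forall p, f (y p * word_val (a :: u) * (y p)^-1) = d p].
Proof.
move=> Vg.
have /choice[y yP] : forall p, exists v, [/\ word_in X v, avoids J v &
    J :* rho (word_val v) = V p].
  move=> p; have [_ /generated_subgroup_word[w wX <-] wg] := dense_fibre (g p) rho_hom gX.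
  by have [v [vX av vE]] := avoiding_word wX; exists v; rewrite Vg -wg.
exists (fun p => word_val (y p)); split=> [p|d dD JD hd].
  by have [_ _ <-] := yP p; exact: rcoset_refl.
have [c0 c0s] := lifts_slopes_exist.
pose k p := path_label rho c0 J (y p).
pose m p := path_label rho c0 (act (V p) a) u.
have kD p : k p \in D by exact: path_label_in.
have mD p : m p \in D by exact: path_label_in.
(* solves k p * beta p * m p * (k p)^-1 = d p *)
pose beta p := (k p)^-1 * d p * k p * (m p)^-1.
have [||c [cs ca cav]] := @prescribe_labels c0 beta c0s.
- by move=> p; rewrite /beta !groupM ?groupV.
- move=> p; have [yX yav yV] := yP p; set s := rho (word_val (y p)) in yV.
  exists s; first by rewrite yV.
  have hk : h (k p) = t s.
    by rewrite /k -[X in path_label _ _ X](rcoset1 J) path_label_slope // t1 invg1 !mul1g.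
  have hm : h (m p) = (t (s * rho (letter_val a)))^-1 * t (s * rho (word_val (a :: u))).
    rewrite /m /act -yV -rcosetM path_label_slope //= (finite_homM rho_hom).
    by rewrite !mulgA.
  rewrite /beta !hM !hV hk hm hd.
  have -> : s * rho (word_val (a :: u)) =
      rho (word_val (y p) * word_val (a :: u) * (word_val (y p))^-1) * s.
    by rewrite !(finite_homM rho_hom) (finite_homV rho_hom) mulgVK.
  by rewrite (tJ s (JD p)) /= !invMg invgK -!mulgA !mulKVg.
have [f [f1 fM fw fX]] := label_cocycle rho_hom J gX X_hom c.
exists f; split=> // [x|x|p].
- by have [w _ [_ ->]] := fw x; exact: path_label_in.
- have [w _ [<- ->]] := fw x.
  by rewrite -[X in path_label _ _ X](rcoset1 J) path_label_slope // t1 invg1 !mul1g.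
have [yX yav yV] := yP p.
have wX : word_in X (a :: u).
  by move=> b; rewrite inE => /orP[/eqP -> //|/uX].
have -> : word_val (y p) * word_val (a :: u) * (word_val (y p))^-1 =
   word_val (y p ++ (a :: u) ++ word_inv (y p)).
  by rewrite !word_val_cat word_val_inv -mulgA.
rewrite fX; last by do 2!apply: word_in_cat => //; exact: word_in_inv.
have pk : path_label rho c J (y p) = k p by rewrite cav.
rewrite path_label_cat // yV path_label_cat // loop -{2}yV path_label_inv // pk /=.
rewrite ca cav; last exact: loop_avoids.
by rewrite -/(m p) /beta mulgVK !mulgA mulgV mul1g mulgK.
Qed.

End Rerouting.

(** * Disjoint simple loops in the coset space *)

Section Thin.
Context (F : topologicalGroupType).
Implicit Types (C O : set F).

(** Closed and nowhere dense; finitely many such sets can be avoided within any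
    nonempty open set. *)
Definition thin C : Prop :=
  closed C /\ forall O, open O -> O !=set0 -> O `\` C !=set0.

Lemma thin_avoid (I : eqType) (s : seq I) (C : I -> set F) O :
  (forall i, i \in s -> thin (C i)) -> open O -> O !=set0 ->
  exists O', [/\ open O', O' !=set0, O' `<=` O &
    forall i x, i \in s -> O' x -> ~ C i x].
Proof.
move=> + oO O0; elim: s => [|i s IH] sC; first by exists O; split.
have [|O' [oO' O'0 O'O O's]] := IH; first by move=> j js; apply: sC; rewrite inE js orbT.
have [clC Cthin] : thin (C i) by apply: sC; rewrite inE eqxx.
exists (O' `\` C i); split.
- by apply: openI => //; exact: closed_openC.
- exact: Cthin.
- by move=> x [/O'O].
- by move=> j x; rewrite inE => /orP[/eqP ->|js] [O'x nCx] //; exact: O's.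
Qed.

Lemma conj_continuous (z : F) : continuous (fun g : F => g * z * g^-1).
Proof.
move=> x; rewrite (_ : (fun _ => _) =
  (fun z : F * F => z.1 * z.2) \o (fun g => (g * z, g^-1))) //.
apply: continuous_comp; last exact: mulg_continuous.
by apply: cvg_pair; [exact: mulr_continuous|exact: invg_continuous].
Qed.

Lemma open_mulr O (z : F) : open O -> open [set y | O (y * z)].
Proof. by move=> oO; have /continuousP := @mulr_continuous F z; apply. Qed.

Lemma thin_mulr C (z : F) : thin C -> thin [set y | C (y * z)].
Proof.
move=> [clC Cthin]; split.
  by apply: (@preimage_closed _ _ (fun y => y * z)) => // x _; exact: mulr_continuous.
move=> O oO [y Oy]; have [|x [Ox nCx]] := Cthin _ (open_mulr z^-1 oO).
- by exists (y * z); rewrite /= mulgK.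
- by exists (x * z^-1); split=> //=; rewrite mulgVK.
Qed.

(** A subgroup with interior points is open, hence of finite index by
    compactness. *)
Lemma thin_infinite_index (H : set F) :
  compact [set: F] -> is_subgroup H -> closed H -> infinite_index H -> thin H.
Proof.
move=> cF Hg clH Hinf; split=> // O oO [x Ox]; apply: contrapT => OH; apply: Hinf.
have {}OH y : O y -> H y.
  by move=> Oy; apply: contrapT => nHy; apply: OH; exists y.
have oH : open H.
  apply: open_subgroup => //.
  have : nbhs (x * 1) O by rewrite mulg1; exact: open_nbhs_nbhs.
  move=> /nbhs_mull; apply: filterS => y /= /OH Hxy.
  rewrite -(mulKg x y); apply: subgroupM => //; apply: subgroupV => //; exact: OH.
have [T [c [c_surj cP]]] := finite_cosets cF Hg oH.
pose rep t := sval (cid (c_surj t)).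
have repK t : c (rep t) = t by rewrite /rep; case: cid.
pose coset (x : F) := [set x * h | h in H].
apply: (@sub_finite_set _ _ [set coset (rep t)^-1 | t in [set: T]]).
  move=> _ [y _ <-]; exists (c y^-1) => //.
  have Hr : H (rep (c y^-1) * y) by rewrite -{2}[y]invgK; apply/cP; rewrite repK.
  apply/seteqP; split=> _ [z Hz <-].
    exists (y^-1 * (rep (c y^-1))^-1 * z); last by rewrite !mulgA mulgV mul1g.
    by apply: subgroupM => //; rewrite -invMg; exact: subgroupV.
  exists (rep (c y^-1) * y * z); last by rewrite -!mulgA mulKg.
  exact: subgroupM.
by apply: finite_image; exact: finite_finset.
Qed.

(** Chosen one after the other: each new point has to avoid finitely many
    translates of the thin set H. The hypothesis on the inverse of z makes the
    conclusion symmetric in p and p'. *)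
Lemma separated_points (H O : set F) (Z : seq F) :
  is_subgroup H -> thin H -> open O -> O !=set0 -> forall I : finType,
  exists g : I -> F, (forall p, O (g p)) /\
    forall p p' z, z \in Z -> z^-1 \in Z -> H (g p * z * (g p')^-1) -> p = p'.
Proof.
move=> Hg Hthin oO O0 I.
have [g gP] : exists g : nat -> F, forall p, p < #|I| -> O (g p) /\
    forall p' z, p' < p -> z \in Z -> ~ H (g p * z * (g p')^-1).
  elim: #|I| => [|m [g gP]]; first by exists (fun=> 1).
  pose s := [seq (z, p') | z <- Z, p' <- iota 0 m].
  have [|O' [oO' [y O'y] O'O O's]] := @thin_avoid _ s
      (fun u => [set y | H (y * (u.1 * (g u.2)^-1))]) O _ oO O0.
    by move=> u _; exact: thin_mulr.
  exists (fun p => if p == m then y else g p) => p.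
  rewrite ltnS leq_eqVlt => /orP[/eqP ->|pm].
    rewrite eqxx; split=> [|p' z p'm zZ]; first exact: O'O.
    rewrite (ltn_eqF p'm) -mulgA; apply: (O's (z, p')) => //.
    by apply/allpairsP; exists (z, p'); rewrite mem_iota.
  have [Op gp] := gP p pm; rewrite (ltn_eqF pm); split=> // p' z p'p zZ.
  by rewrite (ltn_eqF (ltn_trans p'p pm)); exact: gp.
exists (fun p => g (enum_rank p)); split=> [p|p p' z zZ zVZ].
  by have [] := gP (enum_rank p) (ltn_ord _).
move=> Hz; apply: enum_rank_inj; apply: val_inj; apply/eqP.
rewrite eqn_leq [X in X && _]leqNgt [X in _ && X]leqNgt.
apply/andP; split; apply/negP => lt.
  have [_ /(_ _ _ lt zZ)] := gP (enum_rank p) (ltn_ord _); exact.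
have [_ /(_ _ _ lt zVZ)] := gP (enum_rank p') (ltn_ord _); apply.
by have := subgroupV Hg Hz; rewrite !invMg invgK mulgA.
Qed.

End Thin.

Section MinimalWord.
Context (F : topologicalGroupType) (H X : set F).
Hypotheses (Hg : is_subgroup H) (H_closed : closed H).

(** In other words, w fixes the coset H g for each g in O. *)
Definition fixes (w : F) (O : set F) : Prop := forall g, O g -> H (g * w * g^-1).

Definition fixes_somewhere (w : F) : Prop :=
  exists O, [/\ open O, O !=set0 & fixes w O].

Lemma minimal_word :
  (exists w, [/\ word_in X w, word_val w <> 1 & fixes_somewhere (word_val w)]) ->
  exists w, [/\ word_in X w, word_val w <> 1, fixes_somewhere (word_val w) &
    forall w', word_in X w' -> word_val w' <> 1 -> fixes_somewhere (word_val w') ->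
      size w <= size w'].
Proof.
move=> [w0 w0P].
pose P k := `[< exists w, [/\ word_in X w, word_val w <> 1,
  fixes_somewhere (word_val w) & size w = k] >].
have : exists k, P k by exists (size w0); apply/asboolP; exists w0; case: w0P.
move=> /ex_minnP[k /asboolP[w [wX w1 wf <-]] kmin].
exists w; split=> // w' w'X w'1 w'f; by apply: kmin; apply/asboolP; exists w'; split.
Qed.

(** If the coset of g * word_val (take i w) equals that of
    g * word_val (take j w) for all g in an open set, then the subword between
    i and j fixes the translate of that open set. Its value is not 1, since
    otherwise deleting it would shorten w; so it contradicts minimality. *)
Lemma minimal_word_thin (w : seq (letter F)) (O : set F) (i j : nat) :
  open O -> O !=set0 -> fixes (word_val w) O -> word_in X w ->
  word_val w <> 1 ->
  (forall w', word_in X w' -> word_val w' <> 1 -> fixes_somewhere (word_val w') ->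
    size w <= size w') ->
  i < j < size w ->
  thin [set g | H (g * (word_val (take j w) * (word_val (take i w))^-1) * g^-1)].
Proof.
move=> oO O0 wO wX w1 wmin /andP[ij jw].
have jw' := ltnW jw; have iw := ltn_trans ij jw.
set pi := word_val (take i w); set pj := word_val (take j w).
pose v := drop i (take j w).
have pjE : pj = pi * word_val v.
  by rewrite /pj /pi /v -word_val_cat -{1}(cat_take_drop i (take j w)) take_takel // ltnW.
have vX : word_in X v by move=> a /mem_drop/mem_take; exact: wX.
have vw : size v < size w by rewrite size_drop size_takel // (leq_ltn_trans (leq_subr _ _)).
have v1 : word_val v <> 1.
  move=> v1; pose w' := take i w ++ drop j w.
  have w'X : word_in X w' by apply: word_in_cat => a; [move/mem_take|move/mem_drop]; exact: wX.
  have w'w : word_val w' = word_val w.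
    by rewrite word_val_cat -[in RHS](cat_take_drop j w) word_val_cat -/pj pjE v1 mulg1.
  have := wmin w' w'X; rewrite w'w => /(_ w1); rewrite leqNgt => /(_ _)/negP; apply.
    by exists O.
  rewrite size_cat size_takel ?size_drop ?(ltnW iw) //.
  by rewrite -[ltnRHS](subnKC jw') ltn_add2r.
split.
  apply: (@preimage_closed _ _ (fun g => g * (pj * pi^-1) * g^-1)) => // x _.
  exact: conj_continuous.
move=> U oU [y Uy]; apply: contrapT => UH.
have := wmin v vX v1; rewrite leqNgt vw => /(_ _)/negP; apply => //.
exists [set g | U (g * pi^-1)]; split; first exact: open_mulr.
  by exists (y * pi); rewrite /= mulgK.
move=> g Ug; apply: contrapT => nH; apply: UH; exists (g * pi^-1); split=> //= Hg'.
by apply: nH; move: Hg'; rewrite pjE invMg invgK !mulgA !mulgVK.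
Qed.

(** The path of w from the coset of g p visits the cosets of
    g p * word_val (take i w); all of these are distinct, for all p and i. *)
Lemma separated_loops :
  thin H ->
  (exists w, [/\ word_in X w, word_val w <> 1 & fixes_somewhere (word_val w)]) ->
  exists w, [/\ word_in X w, word_val w <> 1 &
    forall I : finType, exists g : I -> F,
      (forall p, \forall y \near g p, H (y * word_val w * y^-1)) /\
      forall p p' i j, i < size w -> j < size w ->
        H (g p * word_val (take i w) * (g p' * word_val (take j w))^-1) ->
        p = p' /\ i = j].
Proof.
move=> Hthin /minimal_word[w [wX w1 [O [oO O0 wO]] wmin]].
exists w; split=> // I; pose l := size w.
pose pre i := word_val (take i w).
pose s := [seq u <- [seq (i, j) | i <- iota 0 l, j <- iota 0 l] | u.1 < u.2].
have [|O' [oO' O'0 O'O O's]] := @thin_avoid F _ s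
   (fun u => [set g | H (g * (pre u.2 * (pre u.1)^-1) * g^-1)]) O _ oO O0.
  move=> [i j]; rewrite mem_filter /= => /andP[ij /allpairsP[[i' j'] /= [_ + [_ jE]]]].
  rewrite mem_iota -jE add0n => /andP[_ jl].
  by apply: (minimal_word_thin oO) => //; rewrite ij.
pose Z := [seq pre i * (pre j)^-1 | i <- iota 0 l, j <- iota 0 l].
have ZP i j : i < l -> j < l -> pre i * (pre j)^-1 \in Z.
  by move=> il jl; apply/allpairsP; exists (i, j); rewrite !mem_iota.
have [g [gO' gZ]] := separated_points Z Hg Hthin oO' O'0 I.
have simple p i j : i < j -> j < l -> ~ H (g p * (pre j * (pre i)^-1) * (g p)^-1).
  move=> ij jl; apply: (O's (i, j)) => //; rewrite mem_filter ij.
  by apply/allpairsP; exists (i, j); rewrite !mem_iota (ltn_trans ij).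
exists g; split=> [p|p p' i j il jl].
  have : nbhs (g p) O' by exact: open_nbhs_nbhs.
  by apply: filterS => y /O'O/wO.
have -> : g p * word_val (take i w) * (g p' * word_val (take j w))^-1 =
   g p * (pre i * (pre j)^-1) * (g p')^-1 by rewrite invMg !mulgA.
move=> Hpp'.
have pp' : p = p' by apply: gZ Hpp'; rewrite ?invMg ?invgK ZP.
split=> //; rewrite -pp' in Hpp'; case: (ltngtP i j) => // ij.
  case: (simple p i j ij jl); have := subgroupV Hg Hpp'.
  by rewrite !invMg !invgK !mulgA.
by case: (simple p j i ij il).
Qed.

End MinimalWord.

(** * Closed subgroups and finite bases *)

Section SubgroupTopology.
Context (F : topologicalGroupType) (H : subgroup F).
Local Notation HT := (subgroup_type H).

Definition subgroup_elt (x : F) (Hx : (H : set F) x) : HT := exist _ x (mem_set Hx).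

Lemma subgroup_val (j : HT) : (H : set F) (val j).
Proof. exact: set_mem (valP j). Qed.

Lemma subgroup_nbhs (j : HT) (U : set HT) :
  nbhs j U -> exists2 U' : set F, nbhs (val j) U' & forall k, U' (val k) -> U k.
Proof.
rewrite nbhsE => -[O [[W oW WO] Oj] OU]; exists W.
  by apply: open_nbhs_nbhs; split=> //; rewrite -[W _]/((set_val @^-1` W) j) WO.
by move=> k Wk; apply: OU; rewrite -WO.
Qed.

Lemma restrict_finite_hom (R : finGroupType) (f : F -> R) :
  finite_hom f -> finite_hom (fun j : HT => f (val j)).
Proof.
move=> fh; split=> [x y|]; first by rewrite valM (finite_homM fh).
have : nbhs (val (1 : HT)) [set x | f x = 1] by rewrite val1; exact: fh.2.
exact: subgroup_val_continuous.
Qed.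

Lemma subgroup_profinite : closed (H : set F) -> profinite_group F -> profinite_group HT.
Proof.
move=> clH [cF hF tF]; split.
- move=> B PB _; have [x [_ clx]] := cF (val @ B) _ filterT.
  have BH : B [set j : HT | (H : set F) (val j)].
    by apply: filterE => j; exact: subgroup_val.
  have Hx : (H : set F) x by apply: clH => U /(clx (H : set F)); exact.
  exists (subgroup_elt Hx); split=> // A U BA /subgroup_nbhs[U' U'x U'U].
  have BA' : B [set j : HT | (val @` A) (val j : F)].
    by apply: filterS BA => j Aj; exists j.
  have [_ [[j Aj <-] U'j]] := clx (val @` A) U' BA' U'x.
  by exists j; split=> //; exact: U'U.
- move=> x y clxy; apply: val_inj; apply: hF => A C Ax Cy.
  have [z [Az Cz]] := clxy (val @^-1` A) (val @^-1` C)
    (subgroup_val_continuous Ax) (subgroup_val_continuous Cy).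
  by exists (val z).
- move=> x _; apply/seteqP; split=> [y [C [Cx _ cC] Cy]|_ ->]; last first.
    exact: connected_component_refl.
  apply: val_inj; suff : connected_component [set: F] (val x) (val y) by rewrite tF.
  exists (val @` C); last by exists y.
  split; [by exists x|by []|].
  apply: connected_continuous_connected => //.
  by apply: continuous_subspaceT; exact: subgroup_val_continuous.
Qed.

End SubgroupTopology.

Section FiniteBasis.
Context (F : topologicalGroupType).

Lemma finite_hom_agree (R : finGroupType) (f f' : F -> R) (X : set F) :
  generates X -> finite_hom f -> finite_hom f' -> (forall x, X x -> f x = f' x) ->
  f =1 f'.
Proof.
move=> gX fh f'h ff' x.
have Dg : group_set [set u : R * R | u.1 == u.2].
  apply/group_setP; split=> [|u v]; first by rewrite inE.
  by rewrite !inE /= => /eqP -> /eqP ->.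
have := generates_image (K := Group Dg) (finite_hom_pair fh f'h) gX _ x.
by rewrite inE /= => H; apply/eqP/H => y Xy; rewrite inE /= ff'.
Qed.

(** A topologically finitely generated group has finitely many continuous
    homomorphisms to 'S_2, whereas each x in X gives one that, on X, is nontrivial
    at x only. *)
Lemma basis_finite (X : set F) :
  topologically_finitely_generated F -> profinite_basis X -> finite_set X.
Proof.
move=> [Y /finite_seqP[s ->] gY] [gX _ Xhom].
pose a : 'S_2 := tperm ord0 ord_max.
have a1 : a <> 1.
  by move=> /permP/(_ ord0); rewrite perm1 tpermL.
have /choice[f fP] : forall x : F, exists f : F -> 'S_2, X x ->
    finite_hom f /\ forall y, X y -> f y = if y == x then a else 1.
  move=> x; have [Xx|nXx] := pselect (X x); last by exists (fun=> 1).
  have [|f [fc fX]] := Xhom 'S_2 (fun y => if y == x then a else 1).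
    apply: (sub_finite_set (B := [set x])); last exact: finite_set1.
    by move=> y /= [_]; case: eqP.
  by exists f => _; split=> [|y /mem_set/fX //]; exact: continuous_finite_hom.
pose c x : option ((size s).-tuple 'S_2) :=
  if `[< X x >] then Some (map_tuple (f x) (in_tuple s)) else None.
have cX : c @^-1` [set u | u <> None] = X.
  by apply/seteqP; split=> x; rewrite /= /c; case: asboolP.
rewrite -cX; apply: finite_preimage; last exact: sub_finite_set (subsetT _) finite_finset.
move=> x y; rewrite cX => /set_mem Xx /set_mem Xy; rewrite /c !asboolT //.
move=> [/eq_in_map fxy]; apply: contrapT => xy.
have [fxh fxX] := fP x Xx; have [fyh fyX] := fP y Xy.
have := finite_hom_agree gY fxh fyh fxy x.
by rewrite fxX // fyX // eqxx (introF eqP xy) => /a1.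
Qed.

Lemma finite_basis_hom (X : set F) : finite_set X -> profinite_basis X ->
  forall (L : finGroupType) (alpha : F -> L),
    exists f : F -> L, finite_hom f /\ forall x, X x -> f x = alpha x.
Proof.
move=> finX [_ _ Xhom] L alpha; have [|f [fc fX]] := Xhom L alpha.
  by apply: sub_finite_set finX => x [].
by exists f; split=> [|x /mem_set/fX //]; exact: continuous_finite_hom.
Qed.

(** Homomorphisms to symmetric groups correspond to lists of values on the finite
    basis X, of which there are countably many. *)
Lemma finite_hom_sequence (X : set F) :
  profinite_group F -> finite_set X -> generates X ->
  (forall (L : finGroupType) (alpha : F -> L),
    exists f : F -> L, finite_hom f /\ forall x, X x -> f x = alpha x) ->
  exists (R : nat -> finGroupType) (f : forall n, F -> R n),
    (forall n, finite_hom (f n)) /\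
    forall U : set F, nbhs 1 U -> exists n, forall x, f n x = 1 -> U x.
Proof.
move=> pF /finite_seqP[s ->] gX Xhom.
pose alpha n (x : F) : 'S_(projT1 (task_at n)) := nth 1 (projT2 (task_at n)) (index x s).
pose f n := sval (cid (Xhom _ (alpha n))).
have fP n : finite_hom (f n) /\ forall x, [set` s] x -> f n x = alpha n x.
  by rewrite /f; case: cid.
exists (fun n => 'S_(projT1 (task_at n))), f; split=> [n|U U1]; first by have [] := fP n.
have [L [h [hh hU]]] := profinite_finite_hom pF U1.
have [c cM c_inj] := perm_embedding L.
have c1 : c 1 = 1 by apply: (mulgI (c 1)); rewrite -cM !mulg1.
have chh : finite_hom (fun x => c (h x)).
  split=> [x y|]; first by rewrite (finite_homM hh) cM.
  by apply: filterS hh.2 => x ->.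
have [n _ nE] := task_at_ge (existT _ #|L| [seq c (h x) | x <- s]) 0.
exists n => x; have [fh fX] := fP n.
move: (f n) fh fX; rewrite /alpha nE /= => fn fh fX.
have -> : fn x = c (h x).
  apply: (finite_hom_agree gX fh chh) => y sy; rewrite fX //.
  by rewrite (nth_map 1) ?index_mem // nth_index.
by rewrite -c1 => /c_inj/hU.
Qed.

End FiniteBasis.

(** * Embedding problems for subgroups of infinite index *)

Section Embedding.
Context (F : topologicalGroupType) (H : subgroup F) (X : set F).
Hypothesis F_profinite : profinite_group F.
Hypothesis H_closed : closed (H : set F).
Hypothesis gX : generates X.
Hypothesis X_hom : forall (L : finGroupType) (alpha : F -> L),
  exists f : F -> L, finite_hom f /\ forall x, X x -> f x = alpha x.
Local Notation HT := (subgroup_type H).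
Let Hg : is_subgroup (H : set F). Proof. exact: subgroup_setP. Qed.

(** All that has been arranged in F, about finitely many points, remains true
    modulo a small open normal subgroup. *)
Lemma finite_level (I : finType) (g : I -> F) (w : seq (letter F))
    (A : finGroupType) (q : HT -> A) :
  finite_hom q ->
  (forall p, \forall y \near g p, (H : set F) (y * word_val w * y^-1)) ->
  (forall p p' i j, i < size w -> j < size w ->
    (H : set F) (g p * word_val (take i w) * (g p' * word_val (take j w))^-1) ->
        p = p' /\ i = j) ->
  exists (R : finGroupType) (rho : F -> R) (J : {group R}),
    [/\ finite_hom rho, J :=: image_set rho H,
    forall j : HT, rho (val j) = 1 -> q j = 1,
    forall p y, J :* rho y = J :* rho (g p) -> (H : set F) (y * word_val w * y^-1) &
    forall p p' i j, i < size w -> j < size w ->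
      J :* rho (g p * word_val (take i w)) = J :* rho (g p' * word_val (take j w)) ->
      p = p' /\ i = j].
Proof.
move=> qh gfix gsep.
pose z (u : I * I * 'I_(size w) * 'I_(size w)) :=
  g u.1.1.1 * word_val (take u.1.2 w) * (g u.1.1.2 * word_val (take u.2 w))^-1.
have near_z : \forall k \near (1 : F), forall u, (H : set F) (z u) \/ ~ (H : set F) (z u * k).
  apply: filter_forall => u; have [Hz|nHz] := pselect ((H : set F) (z u)).
    by apply: filterE => k; left.
  have : nbhs (z u * 1) (~` (H : set F)).
    by rewrite mulg1; apply: open_nbhs_nbhs; split=> //; exact: closed_openC.
  by move=> /nbhs_mull; apply: filterS => k; right.
have near_g : \forall k \near (1 : F), forall p,
    (H : set F) (k * g p * word_val w * (k * g p)^-1).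
  apply: filter_forall => p.
  have : nbhs (1 * g p) [set y | (H : set F) (y * word_val w * y^-1)].
    by rewrite mul1g; exact: gfix.
  by move=> /nbhs_mulr.
have [U U1 Uq] := subgroup_nbhs qh.2; rewrite val1 in U1.
have [R [rho [rho_hom rhoU]]] :=
  profinite_finite_hom F_profinite (filterI U1 (filterI near_z near_g)).
pose J := Group (image_group_set rho_hom Hg).
have JP r : r \in J -> exists2 x, (H : set F) x & rho x = r by move=> /image_setP.
exists R, rho, J; split=> //.
- by move=> j /rhoU[/Uq].
- move=> p y /rcoset_eqP; rewrite mem_rcoset => /JP[x Hx xE].
  have /rhoU[_ [_ /(_ p)]] : rho (x^-1 * (y * (g p)^-1)) = 1.
    by rewrite !(finite_homM rho_hom) !(finite_homV rho_hom) xE mulVg.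
  have -> : x^-1 * (y * (g p)^-1) * g p = x^-1 * y by rewrite -!mulgA mulVg mulg1.
  move=> Hk.
  have -> : y * word_val w * y^-1 = x * (x^-1 * y * word_val w * (x^-1 * y)^-1) * x^-1.
    by rewrite invMg invgK !mulgA mulgV mul1g mulgK.
  apply: subgroupM; [exact: Hg| |exact: subgroupV].
  by apply: subgroupM; [exact: Hg|by []|].
- move=> p p' i j il jl /rcoset_eqP; rewrite mem_rcoset => /JP[x Hx xE].
  apply: gsep => //; pose u := (p, p', Ordinal il, Ordinal jl).
  have /rhoU[_ [/(_ u) + _]] : rho ((z u)^-1 * x) = 1.
    rewrite (finite_homM rho_hom) (finite_homV rho_hom) xE /z /=.
    by rewrite !(finite_homM rho_hom) !(finite_homV rho_hom) !(finite_homM rho_hom) mulVg.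
  by case=> // nH; case: nH; rewrite mulKVg.
Qed.

(** With the representative repr (J :* r), which is 1 for r in J, write r as
    rho(x) times the representative and let t r = q x. *)
Lemma coset_extension (R A : finGroupType) (rho : F -> R) (q : HT -> A) (J : {group R}) :
  finite_hom rho -> finite_hom q -> J :=: image_set rho H ->
  (forall j : HT, rho (val j) = 1 -> q j = 1) ->
  exists t : R -> A, [/\ forall j r, j \in J -> t (j * r) = t j * t r,
    forall r, exists x, t r = q x & forall x : HT, t (rho (val x)) = q x].
Proof.
move=> rho_hom qh JE qker.
have JP r : r \in J -> exists x : HT, rho (val x) = r.
  by rewrite JE => /image_setP[x Hx <-]; exists (subgroup_elt Hx).
have qeq x y : rho (val x) = rho (val y) -> q x = q y.
  move=> xy; apply/eqP; rewrite -divg_eq1 -(finite_homV qh) -(finite_homM qh).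
  apply/eqP/qker; rewrite valM (finite_homM rho_hom) xy -(finite_homM rho_hom).
  by rewrite -valM mulgV val1 (finite_hom1 rho_hom).
have /choice[e eP] : forall r : R, exists x : HT, rho (val x) = r * (repr (J :* r))^-1.
  move=> r; apply: JP; rewrite -mem_rcoset -rcoset_sym; exact: mem_repr_rcoset.
have eJ j : j \in J -> rho (val (e j)) = j.
  by move=> Jj; rewrite eP rcoset_id // repr_group invg1 mulg1.
exists (fun r => q (e r)); split=> [j r Jj|r|x].
- rewrite -(finite_homM qh); apply: qeq.
  by rewrite valM (finite_homM rho_hom) (eJ j Jj) !eP rcosetM (rcoset_id Jj) mulgA.
- by exists (e r).
- apply: qeq; apply: eJ; rewrite JE; apply/image_setP; exists (val x) => //.
  exact: subgroup_val.
Qed.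

Lemma not_injective_pair (m : nat) (A : finType) (e : 'I_m -> A) :
  #|A| < m -> exists i j, i != j /\ e i = e j.
Proof.
move=> Am; apply: contrapT => nex.
have : injective e.
  by move=> i j eij; apply: contrapT => /eqP ij; apply: nex; exists i, j.
by move=> /leq_card; rewrite card_ord leqNgt Am.
Qed.

Theorem subgroup_embedding_solvable :
  infinite_index (H : set F) ->
  (exists w, [/\ word_in X w, word_val w <> 1 & fixes_somewhere (H : set F) (word_val w)]) ->
  embedding_solvable HT.
Proof.
move=> Hinf Hw A B q h D qh hM DE.
have [cF _ _] := F_profinite.
have Hthin := thin_infinite_index cF Hg H_closed Hinf.
have [[|a u] [wX w1 loops]] := separated_loops Hg H_closed Hthin Hw; first by [].
have aX : X a.1 by apply: wX; rewrite inE eqxx.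
have uX : word_in X u by move=> b bu; apply: wX; rewrite inE bu orbT.
(* for each k in B there are more loops than A has elements *)
pose I : finType := (B * 'I_#|A|.+1)%type.
have [g [gfix gsep]] := loops I.
have [R [rho [J [rho_hom JE qker Vfix Vsep]]]] := finite_level qh gfix gsep.
have [t [tJ tq tH]] := coset_extension rho_hom qh JE qker.
pose V (p : I) : {set R} := J :* rho (g p).
have Vpos p i : act rho (V p) a :* rho (word_val (take i u)) =
    J :* rho (g p * word_val (take i.+1 (a :: u))).
  by rewrite /V /act /= !(finite_homM rho_hom) !rcosetM.
have V0 p : V p = J :* rho (g p * word_val (take 0 (a :: u))) by rewrite take0 mulg1.
have Jrho x : (H : set F) x -> rho x \in J.
  by move=> Hx; rewrite JE; apply/image_setP; exists x.
have loop p : V p :* rho (word_val (a :: u)) = V p.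
  have /Jrho/rcoset_id E := Vfix p (g p) erefl.
  rewrite /V -rcosetM -(finite_homM rho_hom) -{2}E -rcosetM.
  by rewrite -(finite_homM rho_hom) mulgVK.
have V_inj : injective V.
  by move=> p p'; rewrite !V0 => /Vsep[].
have interior_start p p' i : i < size u ->
    act rho (V p) a :* rho (word_val (take i u)) <> V p'.
  by move=> iu; rewrite (Vpos p i) V0 => /Vsep[].
have interior_next p p' i : i < size u ->
    act rho (V p) a :* rho (word_val (take i u)) = act rho (V p') a -> i = 0.
  move=> iu; rewrite (Vpos p i) => E.
  suff [_ [->]] : p = p' /\ i.+1 = 1%N by [].
  apply: Vsep => //=; first by rewrite ltnS (leq_ltn_trans _ iu).
  by rewrite [LHS]E take0 /= mulg1 (finite_homM rho_hom) rcosetM.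
pose p0 : I := (1, ord0).
have reduced u' : u <> letter_inv a :: u'.
  move=> uE; have aa : letter_val a * letter_val (letter_inv a) = 1.
    by rewrite letter_val_inv mulgV.
  case: u' uE => [|b u'] uE; first by apply: w1; rewrite uE /= mulg1.
  suff [] : p0 = p0 /\ 2 = 0 by [].
  by apply: Vsep; rewrite uE //= !mulg1 aa mulg1.
have tD r : t r \in h @: D.
  by have [x ->] := tq r; rewrite DE; apply/image_setP; exists x.
have [y [yV lift]] := prescribed_lift rho_hom aX uX loop V_inj interior_start
  interior_next reduced gX X_hom hM tJ tD (fun p => erefl (V p)).
pose w := word_val (a :: u).
have Hyw p : (H : set F) (y p * w * (y p)^-1).
  by apply: (Vfix p); apply/rcoset_eqP; exact: yV.
pose c p : HT := subgroup_elt (Hyw p).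
have /choice[i iP] : forall k : B, exists i : 'I_#|A|.+1 * 'I_#|A|.+1,
    i.1 != i.2 /\ q (c (k, i.1)) = q (c (k, i.2)).
  move=> k; have [i [j [ij eij]]] := @not_injective_pair _ A (fun i => q (c (k, i))) (ltnSn _).
  by exists (i, j).
have /choice[l' lP'] : forall e : A, exists b : B, e \in h @: D -> b \in D /\ h b = e.
  move=> e; have [/imsetP[b Db ->]|eD] := boolP (e \in h @: D); first by exists b.
  by exists 1.
pose l (x : HT) := l' (q x).
have lP x : l x \in D /\ h (l x) = q x.
  by apply: lP'; rewrite DE; apply/image_setP; exists x.
(* of the two loops with equal images under q, the second one is shifted by the
   element k of the kernel *)
pose d p := if p.2 == (i p.1).2 then
  l (c p) * (if (p.1 \in D) && (h p.1 == 1) then p.1 else 1) else l (c p).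
have h1 : h 1 = 1 by apply: (mulgI (h 1)); rewrite -hM !mulg1.
have dD p : d p \in D.
  have [lD _] := lP (c p); rewrite /d; case: ifP => // _; rewrite groupM //.
  by case: ifP => // /andP[].
have hd p : h (d p) = t (rho (y p * w * (y p)^-1)).
  rewrite (tH (c p)); have [_ <-] := lP (c p); rewrite /d; case: ifP => // _.
  by rewrite hM; case: ifP => [/andP[_ /eqP ->]|_]; rewrite ?h1 mulg1.
have [f [f1 fM fD fh fd]] := lift d dD (fun p => Jrho _ (Hyw p)) hd.
have ph : finite_hom (fun x : HT => f (val x)).
  split=> [x x'|]; first by rewrite valM fM //; apply: Jrho; exact: subgroup_val.
  have : nbhs (val (1 : HT)) [set x | f x = 1] by rewrite val1.
  exact: subgroup_val_continuous.
exists (fun x : HT => f (val x)); split=> // [x|]; first by rewrite fh tH.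
apply/eqP; rewrite finset.eqEsubset; apply/andP; split.
  by apply/fintype.subsetP => _ /image_setP[x _ <-].
apply/fintype.subsetP => b Db.
have : h b \in h @: D by exact: imset_f.
rewrite DE => /image_setP[x _ xb]; pose k := (f (val x))^-1 * b.
have kD : k \in D by rewrite groupM ?groupV.
have hk : h k = 1.
  have hV z : h z^-1 = (h z)^-1 by apply: (mulgI (h z)); rewrite -hM !mulgV.
  by rewrite hM hV fh tH xb mulVg.
have [ik eik] := iP k.
apply/image_setP; exists (x * ((c (k, (i k).1))^-1 * c (k, (i k).2))) => //.
rewrite !(finite_homM ph) (finite_homV ph) /= !fd /d /= eqxx (negPf ik) kD hk eqxx /=.
by rewrite /l eik mulKg /k mulVKg.
Qed.
End Embedding.

Theorem theorem1p2 (F : topologicalGroupType)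
    (F_free : free_profinite_group F)
    (F_fg : topologically_finitely_generated F)
    (H : subgroup F)
    (H_closed : closed (H : set F))
    (H_index : infinite_index H)
    (N_ex : exists N : subgroup F,
      [/\ closed (N : set F), normal_subgroup N, N `<=` H &
          exists X : set F, profinite_basis X /\
            exists2 w : F, w <> 1 & (generated_subgroup X `&` N) w]) :
  free_profinite_group_of_rank_aleph0 (subgroup_type H).
Proof.
have [F_profinite _] := F_free.
have [N [_ N_normal NH [X [X_basis [x w1 [Xx Nw]]]]]] := N_ex.
have [w wX wx] := generated_subgroup_word Xx; subst x.
have X_finite := basis_finite F_fg X_basis.
have X_hom := finite_basis_hom X_finite X_basis.
have [gX _ _] := X_basis.
(* w is in the normal subgroup N, so the open set can be the whole group *)
have w_fixes : fixes_somewhere (H : set F) (word_val w).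
  exists setT; split; [exact: openT|by exists 1|] => g _; apply: NH.
  have := N_normal _ g^-1 Nw; rewrite conjgE invgK mulgA; exact.
have H_profinite := subgroup_profinite H_closed F_profinite.
have [cH _ _] := H_profinite.
have [R [f [fh f_cofinal]]] := finite_hom_sequence F_profinite X_finite gX X_hom.
have EP := subgroup_embedding_solvable F_profinite H_closed gX X_hom H_index
  (ex_intro _ w (And3 wX w1 w_fixes)).
have [||Y [Y_inj Y_basis]] := embedding_solvable_basis cH EP
    (f := fun n (x : subgroup_type H) => f n (val x)).
- by move=> n; exact: restrict_finite_hom.
- move=> U /subgroup_nbhs[U' U'1 U'U]; rewrite val1 in U'1.
  by have [n fU] := f_cofinal U' U'1; exists n => x /fU/U'U.
split=> //; exists (range Y) => //.
by apply: inj_card_eq => i j _ _; exact: Y_inj.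
Qed.
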